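(* Let $\{\Phi_t\}_{t\ge0}$ be a quantum dynamical semigroup of unital quantum channels on $M_d$. Then the set $\{t\in[0,\infty):\Phi_t\text{ is not mixed unitary}\}$ is open in $\mathbb{R}$. Moreover, exactly one of the following holds: (i) $\Phi_t$ is mixed unitary for all $t\ge0$; (ii) there exist $0<t_0\le t_1<\infty$ such that $\Phi_t$ is not mixed unitary for every $t\in(0,t_0)$ and $\Phi_t$ is mixed unitary for every $t\in[t_1,\infty)$.
   Context: A quantum dynamical semigroup of unital quantum channels is a family $\{\Phi_t\}_{t\ge0}$ of completely positive, unital, trace-preserving linear maps on $M_d$ with $\Phi_0=\mathrm{id}$, $\Phi_s\Phi_t=\Phi_{s+t}$ and $t\mapsto\Phi_t$ continuous. A channel is mixed unitary if it equals $\sum_{j=1}^\ell\lambda_j\mathrm{Ad}_{U_j}$ with unitaries $U_j$, $\lambda_j\ge0$, $\sum_j\lambda_j=1$, where $\mathrm{Ad}_U(X)=U^*XU$. *)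

(* Defs.v *)
From HB Require Import structures.
From mathcomp Require Import all_boot all_order all_algebra.
From mathcomp Require Import all_classical all_reals all_analysis.
From mathcomp Require Import complex.
Set Implicit Arguments. Unset Strict Implicit. Unset Printing Implicit Defensive.
Import Order.TTheory GRing.Theory Num.Theory.
Import numFieldNormedType.Exports.
Local Open Scope ring_scope.
Local Open Scope complex_scope.
Local Open Scope classical_set_scope.

Section QDS.
Variable R : realType.
Local Notation C := R[i].

Definition mxadj m n (A : 'M[C]_(m, n)) : 'M[C]_(n, m) := (map_mx conjc A)^T.

(* positive semidefinite: x^* A x >= 0 for all x (order on C: real and >= 0) *)
Definition psd n (A : 'M[C]_n) : Prop :=
  forall x : 'cV[C]_n, 0 <= (mxadj x *m A *m x) 0 0.

(* an element B = [B_ij] of M_k(M_d) is positive semidefinite *)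
Definition block_psd d k (B : 'I_k -> 'I_k -> 'M[C]_d) : Prop :=
  forall v : 'I_k -> 'cV[C]_d,
    0 <= \sum_(i < k) \sum_(j < k) (mxadj (v i) *m B i j *m v j) 0 0.

Definition is_linear_map d (Phi : 'M[C]_d -> 'M[C]_d) : Prop :=
  forall (a : C) (X Y : 'M[C]_d), Phi (a *: X + Y) = a *: Phi X + Phi Y.

(* complete positivity: id_k (x) Phi is positive for every k *)
Definition completely_positive d (Phi : 'M[C]_d -> 'M[C]_d) : Prop :=
  forall k (B : 'I_k -> 'I_k -> 'M[C]_d),
    block_psd B -> block_psd (fun i j => Phi (B i j)).

Definition unital d (Phi : 'M[C]_d -> 'M[C]_d) : Prop := Phi 1%:M = 1%:M.

Definition trace_preserving d (Phi : 'M[C]_d -> 'M[C]_d) : Prop :=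
  forall X, \tr (Phi X) = \tr X.

Definition unital_channel d (Phi : 'M[C]_d -> 'M[C]_d) : Prop :=
  [/\ is_linear_map Phi, completely_positive Phi, unital Phi
    & trace_preserving Phi].

Definition unitary_mx d (U : 'M[C]_d) : Prop := mxadj U *m U = 1%:M.

Definition Ad d (U : 'M[C]_d) (X : 'M[C]_d) : 'M[C]_d := mxadj U *m X *m U.

Definition mixed_unitary d (Phi : 'M[C]_d -> 'M[C]_d) : Prop :=
  exists (l : nat) (lam : 'I_l -> R) (U : 'I_l -> 'M[C]_d),
    [/\ forall j, 0 <= lam j, \sum_(j < l) lam j = 1,
        forall j, unitary_mx (U j)
      & forall X, Phi X = \sum_(j < l) (lam j)%:C *: Ad (U j) X].

(* quantum dynamical semigroup of unital channels, indexed by t >= 0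
   (values of Phi at t < 0 are irrelevant) *)
Definition unital_QDS d (Phi : R -> 'M[C]_d -> 'M[C]_d) : Prop :=
  [/\ forall t, 0 <= t -> unital_channel (Phi t),
      Phi 0 =1 id,
      forall s t, 0 <= s -> 0 <= t -> Phi (s + t) =1 Phi s \o Phi t
    & forall X i j,
        {within [set t : R | 0 <= t], continuous ((fun t : R => @complex.Re R (Phi t X i j)) : R -> R)} /\
        {within [set t : R | 0 <= t], continuous ((fun t : R => @complex.Im R (Phi t X i j)) : R -> R)}].

End QDS.

(* Main.v *)
(* Let V be the space of X whose Hilbert-Schmidt norm is preserved by all Phi_t.
   If K_k are Kraus operators of Phi_t, then \sum_k |X K_k - K_k Phi_t(X)|^2 =
   |X|^2 - |Phi_t(X)|^2, so X K_k = K_k Phi_t(X) for X in V. For small t some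
   combination of the K_k is invertible; its polar part, and then its powers, give
   for every t a unitary U_t with Phi_t = Ad_{U_t} on V. Thus Psi_t = Ad_{U_t^*} Phi_t
   fixes V and has its Kraus operators in the commutant A of V. Let E be the mean of
   Ad_U over the unitaries U of A. On the orthogonal complement of V, Phi_t tends
   to 0, hence Psi_t tends to E. Now E is relatively interior to
   conv {Ad_U : U in U(A)}, and Psi_t lies in the span of the Ad_U because a linear
   functional killing all Ad_U induces a Jordan derivation of A, which is inner.
   So Psi_t, and with it Phi_t, is mixed unitary for large t. The set of mixed
   unitary maps is closed (Caratheodory and compactness) and stable under
   composition, which gives openness and the dichotomy near 0. *)

Require Import Defs.
From HB Require Import structures.
From mathcomp Require Import all_boot all_order all_algebra.
From mathcomp Require Import all_classical all_reals all_analysis.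
From mathcomp Require Import complex.
From mathcomp Require Import ring lra.
Import Order.TTheory GRing.Theory Num.Theory.
Import numFieldNormedType.Exports.
Local Open Scope ring_scope.
Local Open Scope classical_set_scope.

Set Implicit Arguments.
Unset Strict Implicit.
Unset Printing Implicit Defensive.

(** As t grows, Phi_t need not converge, since it may rotate V forever; this is what dividing by U_t
    removes. No regularity of U_t in t is needed: the distance to E is measured in a norm that
    conjugation by a unitary preserves, so one threshold in t suffices. The combination of Kraus
    operators used for U_t is \sum_k conj (tr K_k) K_k, which depends on Phi_t alone and tends to d
    times the identity as t tends to 0. A functional on maps sees Ad_U only through an expression
    quadratic in U, so just symmetrised information about a bilinear form on A is available. This is
    why only a Jordan derivation arises. The usual proof of innerness by averaging over translations
    U -> V U is therefore run with U -> V U V, which the Jordan triple product rule controls. Haar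
    measure is avoided: E is the element of least norm of a compact convex set. Compactness is used
    through limits along a nonprincipal ultrafilter, along which every bounded sequence converges,
    so no subsequences are extracted. *)

Local Notation "A ^h" := (mxadj A) (at level 8, format "A ^h").

(** * Adjoints, unitaries and functional calculus of hermitian matrices *)

Section Adjoint.
Variable R : realType.
Local Notation C := R[i].
Implicit Types (m n p : nat).

Lemma mxadjE m n (A : 'M[C]_(m, n)) i j : A^h i j = conjc (A j i).
Proof. by rewrite !mxE. Qed.

Lemma mxadjK m n (A : 'M[C]_(m, n)) : A^h^h = A.
Proof. by apply/matrixP=> i j; rewrite !mxadjE conjcK. Qed.

Lemma mxadjD m n (A B : 'M[C]_(m, n)) : (A + B)^h = A^h + B^h.
Proof. by apply/matrixP=> i j; rewrite !mxE rmorphD. Qed.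

Lemma mxadjB m n (A B : 'M[C]_(m, n)) : (A - B)^h = A^h - B^h.
Proof. by apply/matrixP=> i j; rewrite !mxE rmorphB. Qed.

Lemma mxadjZ m n a (A : 'M[C]_(m, n)) : (a *: A)^h = conjc a *: A^h.
Proof. by apply/matrixP=> i j; rewrite !mxE rmorphM. Qed.

Lemma mxadj0 m n : (0 : 'M[C]_(m, n))^h = 0.
Proof. by apply/matrixP=> i j; rewrite !mxE rmorph0. Qed.

Lemma mxadj1 n : (1%:M : 'M[C]_n)^h = 1%:M.
Proof.
apply/matrixP=> i j; rewrite !mxE eq_sym.
by case: eqP => _; rewrite (rmorph1,rmorph0).
Qed.

Lemma mxadjM m n p (A : 'M[C]_(m, n)) (B : 'M[C]_(n, p)) :
  (A *m B)^h = B^h *m A^h.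
Proof.
apply/matrixP=> i j; rewrite !mxE rmorph_sum; apply: eq_bigr => k _.
by rewrite !mxE rmorphM mulrC.
Qed.

Lemma mxadj_sum m n (I : finType) (F : I -> 'M[C]_(m, n)) :
  (\sum_i F i)^h = \sum_i (F i)^h.
Proof. by apply: (big_morph _ (@mxadjD m n)); exact: mxadj0. Qed.

Lemma mxtrace_adj n (A : 'M[C]_n) : \tr A^h = conjc (\tr A).
Proof. by rewrite /mxtrace rmorph_sum; apply: eq_bigr => i _; rewrite mxadjE. Qed.

Lemma mxadj_trmxC m n (A : 'M[C]_(m, n)) : A^h = map_mx Num.conj (A^T).
Proof. by apply/matrixP=> i j; rewrite !mxE. Qed.

Lemma unitary_mxE n (U : 'M[C]_n) : unitary_mx U -> U *m U^h = 1%:M.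
Proof. by move=> /mulmx1C. Qed.

Lemma unitary_adj n (U : 'M[C]_n) : unitary_mx U -> unitary_mx U^h.
Proof. by move=> /unitary_mxE; rewrite /unitary_mx mxadjK. Qed.

Lemma unitary_mul n (U V : 'M[C]_n) :
  unitary_mx U -> unitary_mx V -> unitary_mx (U *m V).
Proof.
rewrite /unitary_mx mxadjM => hU hV.
by rewrite mulmxA -(mulmxA V^h) hU mulmx1.
Qed.

Lemma unitary1 n : unitary_mx (1%:M : 'M[C]_n).
Proof. by rewrite /unitary_mx mxadj1 mulmx1. Qed.

(** Functional calculus in the orthonormal basis formed by the columns of [Q^h]. The function is
    indexed by basis vectors and not by eigenvalues, so it may separate equal eigenvalues; where
    this matters, a compatibility hypothesis is added. *)
Definition spectral_fun n (Q : 'M[C]_n) (g : 'I_n -> C) : 'M[C]_n :=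
  Q^h *m diag_mx (\row_i g i) *m Q.

Lemma diag_mx_row_mul n (g h : 'I_n -> C) :
  diag_mx (\row_i g i) *m diag_mx (\row_i h i) = diag_mx (\row_i (g i * h i)).
Proof. by rewrite mulmx_diag; congr diag_mx; apply/rowP=> i; rewrite !mxE. Qed.

Lemma spectral_funM n (Q : 'M[C]_n) (g h : 'I_n -> C) : unitary_mx Q ->
  spectral_fun Q g *m spectral_fun Q h = spectral_fun Q (fun i => g i * h i).
Proof.
move=> /unitary_mxE hQ; rewrite /spectral_fun -diag_mx_row_mul !mulmxA.
by rewrite -(mulmxA _ Q) hQ mulmx1.
Qed.

Lemma spectral_fun_adj n (Q : 'M[C]_n) (g : 'I_n -> C) :
  (spectral_fun Q g)^h = spectral_fun Q (fun i => conjc (g i)).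
Proof.
rewrite /spectral_fun !mxadjM mxadjK mulmxA; congr (_ *m _ *m _).
apply/matrixP=> i j; rewrite !mxE eq_sym.
by case: eqP => [->|_]; rewrite ?mulr1n ?mulr0n ?rmorph0.
Qed.

Lemma spectral_fun1 n (Q : 'M[C]_n) : unitary_mx Q -> spectral_fun Q (fun=> 1) = 1%:M.
Proof.
move=> hQ; rewrite /spectral_fun; suff -> : diag_mx (\row_(i < n) 1) = 1%:M :> 'M[C]_n.
  by rewrite mulmx1.
by apply/matrixP=> i j; rewrite !mxE.
Qed.

Lemma spectral_fun_lin n (Q : 'M[C]_n) (I : finType) (c : I -> C) (g : I -> 'I_n -> C) :
  \sum_k c k *: spectral_fun Q (g k) = spectral_fun Q (fun i => \sum_k c k * g k i).
Proof.
rewrite /spectral_fun; have -> : diag_mx (\row_i (\sum_k c k * g k i)) =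
  \sum_k c k *: diag_mx (\row_i g k i).
  apply/matrixP=> i j; rewrite !mxE summxE; case: eqP => [->|hij].
    by rewrite mulr1n; apply: eq_bigr => k _; rewrite !mxE eqxx mulr1n.
  rewrite mulr0n big1 // => k _; rewrite !mxE; case: eqP => [/hij//|_].
  by rewrite mulr0n mulr0.
rewrite mulmx_sumr mulmx_suml; apply: eq_bigr => k _.
by rewrite -scalemxAr -scalemxAl.
Qed.

Lemma eq_spectral_fun n (Q : 'M[C]_n) (g h : 'I_n -> C) :
  g =1 h -> spectral_fun Q g = spectral_fun Q h.
Proof.
move=> e; rewrite /spectral_fun; congr (_ *m diag_mx _ *m _).
by apply/rowP=> i; rewrite !mxE.
Qed.

(** In the eigenbasis, commuting with [diag g] kills every entry (i, j) with [g i != g j]. At the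
    surviving entries [h i = h j], which is all that commuting with [diag h] requires. *)
Lemma spectral_fun_comm n (Q Z : 'M[C]_n) (g h : 'I_n -> C) : unitary_mx Q ->
  (forall i j, g i = g j -> h i = h j) ->
  Z *m spectral_fun Q g = spectral_fun Q g *m Z -> Z *m spectral_fun Q h = spectral_fun Q h *m Z.
Proof.
move=> hQ gh e; have hQ' := unitary_mxE hQ.
pose Z' := Q *m Z *m Q^h.
have conj k : Z *m spectral_fun Q k = spectral_fun Q k *m Z <->
    Z' *m diag_mx (\row_i k i) = diag_mx (\row_i k i) *m Z'.
  rewrite /Z' /spectral_fun; split=> ek.
    have := congr1 (fun M => Q *m M *m Q^h) ek.
    rewrite !mulmxA hQ' mul1mx -!mulmxA hQ' mulmx1 !mulmxA => ->.
    by rewrite -!mulmxA.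
  have := congr1 (fun M => Q^h *m M *m Q) ek.
  rewrite !mulmxA hQ mul1mx => ->.
  by rewrite -!mulmxA hQ mulmx1.
apply/conj; move/conj: e => e; clearbody Z'; apply/matrixP => i j.
have := congr1 (fun M : 'M[C]_n => M i j) e.
rewrite !mul_mx_diag !mul_diag_mx !mxE => eij.
have [/gh ->|/eqP ne] := eqVneq (g i) (g j); first by rewrite mulrC.
have : (g i - g j) * Z' i j = 0 by rewrite mulrBl -eij [Z' i j * _]mulrC subrr.
move=> /eqP; rewrite mulf_eq0 subr_eq0 => /orP[/eqP//|/eqP ->].
by rewrite mulr0 mul0r.
Qed.

Lemma hermitian_spectral n (H : 'M[C]_n) : H^h = H ->
  exists (Q : 'M[C]_n) (a : 'I_n -> R),
    unitary_mx Q /\ H = spectral_fun Q (fun i => (a i)%:C%C).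
Proof.
move=> hH; have Hn : H \is normalmx.
  by apply/normalmxP; rewrite -mxadj_trmxC hH.
have /orthomx_spectralP e := Hn; set Q := spectralmx H in e.
have hQ0 : Q \is unitarymx by exact: spectral_unitarymx.
rewrite invmx_unitary // -mxadj_trmxC in e.
have hQ' : Q *m Q^h = 1%:M by have /unitarymxP := hQ0; rewrite -mxadj_trmxC.
have hQ : unitary_mx Q by exact: mulmx1C.
clear hQ0; clearbody Q; move: (spectral_diag H) e => D e.
have {}e : H = spectral_fun Q (fun i => D 0 i).
  rewrite e /spectral_fun; congr (_ *m diag_mx _ *m _).
  by apply/rowP => i; rewrite mxE.
have rl i : conjc (D 0 i) = D 0 i.
  have := hH; rewrite e spectral_fun_adj /spectral_fun.
  move/(congr1 (fun M => Q *m M *m Q^h)).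
  rewrite !mulmxA hQ' !mul1mx -!mulmxA hQ' !mulmx1.
  by move/(congr1 (fun M : 'M[C]_n => M i i)); rewrite !mxE eqxx !mulr1n.
exists Q, (fun i => complex.Re (D 0 i)); split=> //.
rewrite e; apply: eq_spectral_fun => i; have := rl i.
case: (D 0 i) => x y /= [] /eqP; rewrite eq_sym -addr_eq0 -mulr2n.
by rewrite mulrn_eq0 /= => /eqP ->.
Qed.

End Adjoint.

(** * Limits along an ultrafilter, for real, complex and matrix sequences *)

Section UltraLimit.
Variable R : realType.
Local Notation C := R[i].
Variable F : set_system nat.
Context {FU : UltraFilter F}.

(** A compact segment provides a cluster point, and an ultrafilter converges to each of its cluster
    points. *)
Lemma ultra_bounded_cvg (u : nat -> R) (M : R) :
  (forall n, `|u n| <= M) -> exists l : R, u @ F --> l.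
Proof.
move=> uM.
have FI : fmap u F `[- M, M].
  apply: (@filterS _ F _ setT) filterT => n _ /=.
  by rewrite in_itv /= -ler_norml.
have [l [_ cl]] := @segment_compact R (- M) M _ _ FI.
exists l => A lA; have [//|FA] := in_ultra_setVsetC (u @^-1` A) FU.
have [x [nAx Ax]] := cl (~` A) A FA lA.
by case: nAx.
Qed.

(** Real and imaginary parts are kept apart because continuity of the semigroup is given in that
    form in [unital_QDS]. *)
Definition ccvg (u : nat -> C) (l : C) :=
  ((fun n => complex.Re (u n)) @ F --> complex.Re l) /\
  ((fun n => complex.Im (u n)) @ F --> complex.Im l).

Lemma ccvg_cst (c : C) : ccvg (fun=> c) c.
Proof. by split; apply: cvg_cst. Qed.

Lemma ccvgD u v a b : ccvg u a -> ccvg v b -> ccvg (fun n => u n + v n) (a + b).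
Proof.
move=> [ur ui] [vr vi]; split.
  rewrite raddfD /=; under eq_fun do rewrite raddfD /=; exact: cvgD.
by rewrite raddfD /=; under eq_fun do rewrite raddfD /=; exact: cvgD.
Qed.

Lemma ReM (x y : C) : complex.Re (x * y) =
  complex.Re x * complex.Re y - complex.Im x * complex.Im y.
Proof. by case: x y => a b [c d]. Qed.

Lemma ImM (x y : C) : complex.Im (x * y) =
  complex.Re x * complex.Im y + complex.Im x * complex.Re y.
Proof. by case: x y => a b [c d]. Qed.

Lemma ccvgM u v a b : ccvg u a -> ccvg v b -> ccvg (fun n => u n * v n) (a * b).
Proof.
move=> [ur ui] [vr vi]; split.
  rewrite ReM; under eq_fun do rewrite ReM.
  by apply: cvgB; apply: cvgM.
rewrite ImM; under eq_fun do rewrite ImM.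
by apply: cvgD; apply: cvgM.
Qed.

Lemma ccvg_conj u a : ccvg u a -> ccvg (fun n => conjc (u n)) (conjc a).
Proof.
have RJ (z : C) : complex.Re (conjc z) = complex.Re z by case: z.
have IJ (z : C) : complex.Im (conjc z) = - complex.Im z by case: z.
move=> [ur ui]; split.
  by rewrite RJ; under eq_fun do rewrite RJ.
by rewrite IJ; under eq_fun do rewrite IJ; exact: cvgN.
Qed.

Lemma ccvg_real (u : nat -> R) (a : R) : u @ F --> a -> ccvg (fun n => (u n)%:C%C) (a%:C%C).
Proof. by move=> ua; split => //=; exact: cvg_cst. Qed.

Lemma ccvg_sum (I : finType) (u : I -> nat -> C) (a : I -> C) :
  (forall i, ccvg (u i) (a i)) -> ccvg (fun n => \sum_i u i n) (\sum_i a i).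
Proof.
move=> ua; elim: (index_enum I) => [|i s ih].
  by rewrite big_nil; under eq_fun do rewrite big_nil; exact: ccvg_cst.
by rewrite big_cons; under eq_fun do rewrite big_cons; exact: ccvgD.
Qed.

Lemma ccvg_uniq u a b : ccvg u a -> ccvg u b -> a = b.
Proof.
move=> [ur ui] [ur' ui']; apply/eqP; rewrite eq_complex.
by apply/andP; split; apply/eqP; [apply: cvg_unique ur ur'|apply: cvg_unique ui ui'].
Qed.

Lemma ccvg_bounded (u : nat -> C) (M : R) :
  (forall n, complex.Re (u n) ^+ 2 + complex.Im (u n) ^+ 2 <= M) ->
  exists l, ccvg u l.
Proof.
move=> uM.
(* A crude bound that avoids square roots: |x| <= x^2 + 1. *)
have M1 (x y : R) : x ^+ 2 + y ^+ 2 <= M -> `|x| <= M + 1.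
  move=> h; rewrite ler_norml; apply/andP; split; nra.
have [a ha] := ultra_bounded_cvg (fun n => M1 _ _ (uM n)).
have uM' n : complex.Im (u n) ^+ 2 + complex.Re (u n) ^+ 2 <= M by rewrite addrC.
have [b hb] := ultra_bounded_cvg (fun n => M1 _ _ (uM' n)).
by exists (Complex a b).
Qed.

Definition mcvg m n (u : nat -> 'M[C]_(m, n)) (a : 'M[C]_(m, n)) :=
  forall i j, ccvg (fun k => u k i j) (a i j).

Lemma mcvg_cst m n (a : 'M[C]_(m, n)) : mcvg (fun=> a) a.
Proof. by move=> i j; exact: ccvg_cst. Qed.

Lemma mcvgZ m n c z (u : nat -> 'M[C]_(m, n)) a :
  ccvg c z -> mcvg u a -> mcvg (fun k => c k *: u k) (z *: a).
Proof.
move=> cz ua i j; rewrite mxE; under eq_fun do rewrite mxE.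
exact: ccvgM.
Qed.

Lemma mcvgM m n p (u : nat -> 'M[C]_(m, n)) (v : nat -> 'M[C]_(n, p)) a b :
  mcvg u a -> mcvg v b -> mcvg (fun k => u k *m v k) (a *m b).
Proof.
move=> ua vb i j; rewrite mxE; under eq_fun do rewrite mxE.
by apply: ccvg_sum => k; exact: ccvgM.
Qed.

Lemma mcvg_adj m n (u : nat -> 'M[C]_(m, n)) a :
  mcvg u a -> mcvg (fun k => (u k)^h) a^h.
Proof.
move=> ua i j; rewrite mxadjE; under eq_fun do rewrite mxadjE.
exact: ccvg_conj.
Qed.

Lemma mcvg_sum m n (I : finType) (u : I -> nat -> 'M[C]_(m, n)) a :
  (forall i, mcvg (u i) (a i)) -> mcvg (fun k => \sum_i u i k) (\sum_i a i).
Proof.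
move=> ua i j; rewrite summxE; under eq_fun do rewrite summxE.
by apply: ccvg_sum => k; exact: ua.
Qed.

Lemma mcvg_uniq m n (u : nat -> 'M[C]_(m, n)) a b : mcvg u a -> mcvg u b -> a = b.
Proof. by move=> ua ub; apply/matrixP => i j; exact: ccvg_uniq (ua i j) (ub i j). Qed.

Lemma mcvg_tr n (u : nat -> 'M[C]_n) a : mcvg u a -> ccvg (fun k => \tr (u k)) (\tr a).
Proof. by move=> ua; apply: ccvg_sum => i; exact: ua. Qed.

Lemma eventually_ultra (u : nat -> R) (a : R) : \oo `<=` F ->
  u @ \oo --> a -> u @ F --> a.
Proof. by move=> sF ua A /ua /sF. Qed.

Lemma ccvg_prod (I : finType) (u : I -> nat -> C) (a : I -> C) :
  (forall i, ccvg (u i) (a i)) -> ccvg (fun n => \prod_i u i n) (\prod_i a i).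
Proof.
move=> ua; elim: (index_enum I) => [|i s ih].
  by rewrite big_nil; under eq_fun do rewrite big_nil; exact: ccvg_cst.
by rewrite big_cons; under eq_fun do rewrite big_cons; exact: ccvgM.
Qed.

Lemma ccvg_det n (u : nat -> 'M[C]_n) a :
  mcvg u a -> ccvg (fun k => \det (u k)) (\det a).
Proof.
move=> ua; apply: ccvg_sum => s; apply: ccvgM; first exact: ccvg_cst.
by apply: ccvg_prod => i; exact: ua.
Qed.

Lemma ultra_cvg_ge (u : nat -> R) (a l : R) :
  (forall n, a <= u n) -> u @ F --> l -> a <= l.
Proof.
move=> h ul; apply: (@closed_cvg _ _ F _ u (fun x => a <= x)) ul.
  exact: closed_ge.
exact: nearW.
Qed.

Lemma ultra_cvg_le (u : nat -> R) (a l : R) :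
  (forall n, u n <= a) -> u @ F --> l -> l <= a.
Proof.
move=> h ul; apply: (@closed_cvg _ _ F _ u (fun x => x <= a)) ul.
  exact: closed_le.
exact: nearW.
Qed.

Lemma real_cvg_sum (I : finType)
    (u : I -> nat -> R) (a : I -> R) :
  (forall i, u i @ F --> a i) -> (fun n => \sum_i u i n) @ F --> \sum_i a i.
Proof.
move=> ua; elim: (index_enum I) => [|i s ih].
  by rewrite big_nil; under eq_fun do rewrite big_nil; exact: cvg_cst.
by rewrite big_cons; under eq_fun do rewrite big_cons; exact: cvgD.
Qed.

Lemma ultra_natmul_ge (s : R) : \oo `<=` F ->
  F [set n | s <= n%:R].
Proof. by move=> sF; apply: sF; exact: nbhs_infty_ger. Qed.

End UltraLimit.

Lemma nonprincipal_ultra : exists F : set_system nat, UltraFilter F /\ \oo `<=` F.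
Proof. exact: ultraFilterLemma. Qed.

(** * The Hilbert-Schmidt inner product and norm *)

Section HilbertSchmidt.
Variable R : realType.
Local Notation C := R[i].

Definition hs m n (X Y : 'M[C]_(m, n)) : C := \tr (X^h *m Y).
(** Real valued by construction, so that norms can be compared and passed to the limit in R;
    [sqnormE] is the bridge to the complex inner product. *)
Definition sqnorm m n (X : 'M[C]_(m, n)) : R :=
  \sum_i \sum_j (complex.Re (X i j) ^+ 2 + complex.Im (X i j) ^+ 2).

Lemma sqnormE m n (X : 'M[C]_(m, n)) : (sqnorm X)%:C%C = hs X X.
Proof.
rewrite /sqnorm /hs /mxtrace exchange_big rmorph_sum; apply: eq_bigr => i _.
rewrite mxE rmorph_sum; apply: eq_bigr => j _.
rewrite mxadjE; case: (X j i) => a b /=.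
apply/eqP; rewrite eq_complex /=; apply/andP; split; apply/eqP; ring.
Qed.

Lemma sqnorm_ge0 m n (X : 'M[C]_(m, n)) : 0 <= sqnorm X.
Proof. by do 2 (apply: sumr_ge0 => ? _); rewrite addr_ge0 ?sqr_ge0. Qed.

Lemma sqnorm_entry m n (X : 'M[C]_(m, n)) i j :
  complex.Re (X i j) ^+ 2 + complex.Im (X i j) ^+ 2 <= sqnorm X.
Proof.
rewrite /sqnorm (bigD1 i) //= (bigD1 j) //= -addrA lerDl addr_ge0 //.
  by apply: sumr_ge0 => ? _; rewrite addr_ge0 ?sqr_ge0.
by do 2 (apply: sumr_ge0 => ? _); rewrite addr_ge0 ?sqr_ge0.
Qed.

Lemma sqnorm_eq0 m n (X : 'M[C]_(m, n)) : sqnorm X = 0 -> X = 0.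
Proof.
move=> h; apply/matrixP => i j; rewrite mxE.
have := sqnorm_entry X i j; rewrite h => le0; apply/eqP; rewrite eq_complex /=.
apply/andP; split; apply/eqP; nra.
Qed.

Lemma sqnorm_0 m n : sqnorm (0 : 'M[C]_(m, n)) = 0.
Proof. by apply: big1 => i _; apply: big1 => j _; rewrite mxE /= expr0n addr0. Qed.

Lemma hsDr m n (X Y Z : 'M[C]_(m, n)) : hs X (Y + Z) = hs X Y + hs X Z.
Proof. by rewrite /hs mulmxDr raddfD. Qed.
Lemma hsDl m n (X Y Z : 'M[C]_(m, n)) : hs (X + Y) Z = hs X Z + hs Y Z.
Proof. by rewrite /hs mxadjD mulmxDl raddfD. Qed.
Lemma hsBr m n (X Y Z : 'M[C]_(m, n)) : hs X (Y - Z) = hs X Y - hs X Z.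
Proof. by rewrite /hs mulmxBr raddfB. Qed.
Lemma hsBl m n (X Y Z : 'M[C]_(m, n)) : hs (X - Y) Z = hs X Z - hs Y Z.
Proof. by rewrite /hs mxadjB mulmxBl raddfB. Qed.
Lemma hsZr m n a (X Y : 'M[C]_(m, n)) : hs X (a *: Y) = a * hs X Y.
Proof. by rewrite /hs -scalemxAr mxtraceZ. Qed.
Lemma hsZl m n a (X Y : 'M[C]_(m, n)) : hs (a *: X) Y = conjc a * hs X Y.
Proof. by rewrite /hs mxadjZ -scalemxAl mxtraceZ. Qed.
Lemma hs_sumr m n (I : finType) (X : 'M[C]_(m, n)) Y :
  hs X (\sum_(i : I) Y i) = \sum_i hs X (Y i).
Proof. by rewrite /hs mulmx_sumr raddf_sum. Qed.
Lemma hs_suml m n (I : finType) (X : I -> 'M[C]_(m, n)) Y :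
  hs (\sum_(i : I) X i) Y = \sum_i hs (X i) Y.
Proof. by rewrite /hs mxadj_sum mulmx_suml raddf_sum. Qed.

Lemma hs_conj m n (X Y : 'M[C]_(m, n)) : conjc (hs X Y) = hs Y X.
Proof. by rewrite /hs -mxtrace_adj mxadjM mxadjK. Qed.

Lemma hs_nondeg m n (X Y : 'M[C]_(m, n)) : (forall Z, hs Z X = hs Z Y) -> X = Y.
Proof.
move=> h; apply/eqP; rewrite -subr_eq0; apply/eqP/sqnorm_eq0.
by apply: complexI; rewrite sqnormE hsBr h subrr.
Qed.

Lemma sqnorm_adj m n (X : 'M[C]_(m, n)) : sqnorm X^h = sqnorm X.
Proof. by apply: complexI; rewrite !sqnormE /hs mxadjK mxtrace_mulC. Qed.

Lemma sqnorm_parallelogram m n (X Y : 'M[C]_(m, n)) :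
  sqnorm (X + Y) + sqnorm (X - Y) = 2 * sqnorm X + 2 * sqnorm Y.
Proof.
apply: complexI; rewrite !rmorphD !rmorphM /= rmorph_nat !sqnormE hsBr !hsBl !hsDr !hsDl.
ring.
Qed.

Lemma sqnorm_cvg (F : set_system nat) {FF : UltraFilter F} m n (u : nat -> 'M[C]_(m, n)) a :
  mcvg F u a -> (fun k => sqnorm (u k)) @ F --> sqnorm a.
Proof.
move=> ua; have := mcvg_tr (mcvgM (mcvg_adj ua) ua).
by rewrite -/(hs a a) -sqnormE; under eq_fun do rewrite -[\tr _]/(hs _ _) -sqnormE; case.
Qed.

Lemma mcvg_bounded (F : set_system nat) {FF : UltraFilter F} m n
  (u : nat -> 'M[C]_(m, n)) (M : R) :
  (forall k, sqnorm (u k) <= M) -> exists a, mcvg F u a.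
Proof.
move=> uM.
have h i j : exists l, ccvg F (fun k => u k i j) l.
  by apply: (@ccvg_bounded _ _ _ _ M) => k; apply: le_trans (sqnorm_entry _ i j) (uM k).
pose l i j := projT1 (cid (h i j)).
exists (\matrix_(i, j) l i j) => i j; rewrite mxE.
exact: (projT2 (cid (h i j))).
Qed.

End HilbertSchmidt.

(** * Kraus operators and the defect identity of unital channels *)

Section Kraus.
Variable R : realType.
Local Notation C := R[i].

Lemma spectral_fun_form n (Q : 'M[C]_n) (g : 'I_n -> C) k : unitary_mx Q ->
  let x := Q^h *m delta_mx k (0 : 'I_1) in (x^h *m spectral_fun Q g *m x) 0 0 = g k.
Proof.
move=> /unitary_mxE hQ x; rewrite /x /spectral_fun mxadjM mxadjK !mulmxA.
rewrite -(mulmxA _ Q) hQ mulmx1 -(mulmxA _ Q) hQ mulmx1.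
rewrite mul_mx_diag !mxE (bigD1 k) //= big1 ?addr0 => [|i ik].
  by rewrite !mxE !eqxx rmorph1 mul1r mulr1.
by rewrite !mxE (negPf ik) mulr0.
Qed.

(** [psd] does not include hermitian symmetry; over the complex numbers it follows from the
    quadratic form being real. The factor is then the positive square root of P. *)
Lemma psd_gram n (P : 'M[C]_n) : psd P -> exists B : 'M[C]_n, P = B^h *m B.
Proof.
move=> hP.
have real_form (x : 'cV[C]_n) : (x^h *m P^h *m x) 0 0 = (x^h *m P *m x) 0 0.
  have -> : x^h *m P^h *m x = (x^h *m P *m x)^h by rewrite !mxadjM mxadjK mulmxA.
  rewrite mxadjE; have := hP x; case: (_ 0 0) => a b.
  by rewrite lecE /= => /andP[/eqP -> _]; rewrite oppr0.
have hermP : P^h = P.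
  (* the quadratic form of H vanishes, hence so do its eigenvalues *)
  set H := Complex 0 1 *: (P - P^h).
  have hH : H^h = H.
    rewrite /H mxadjZ mxadjB mxadjK -[RHS]opprK -scalerN opprB -scaleNr.
    by congr (_ *: _); apply/eqP; rewrite eq_complex /= oppr0 !eqxx.
  have [Q [a [hQ eH]]] := hermitian_spectral hH.
  have H0 (x : 'cV[C]_n) : (x^h *m H *m x) 0 0 = 0.
    rewrite /H -scalemxAr -scalemxAl mulmxBr mulmxBl mxE.
    by rewrite [X in _ * X]mxE [X in _ + X]mxE real_form subrr mulr0.
  have a0 k : (a k)%:C%C = 0 by rewrite -(H0 (Q^h *m delta_mx k 0)) eH spectral_fun_form.
  have : H = 0.
    rewrite eH /spectral_fun; suff -> : diag_mx (\row_i (a i)%:C%C) = 0 :> 'M[C]_n.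
      by rewrite mulmx0 mul0mx.
    by apply/matrixP => i j; rewrite !mxE a0 mul0rn.
  move/eqP; rewrite /H scaler_eq0 => /orP[|].
    by rewrite eq_complex /= eqxx oner_eq0.
  by rewrite subr_eq0 => /eqP <-.
have [Q [a [hQ eP]]] := hermitian_spectral hermP.
have a0 k : 0 <= a k.
  by have := hP (Q^h *m delta_mx k 0); rewrite eP spectral_fun_form // ler0c.
exists (spectral_fun Q (fun k => (Num.sqrt (a k))%:C%C)).
rewrite spectral_fun_adj spectral_funM // eP; apply: eq_spectral_fun => i.
by rewrite conjc_real -rmorphM /= -expr2 sqr_sqrtr.
Qed.

Lemma linear_map0 d (Phi : 'M[C]_d -> 'M[C]_d) : is_linear_map Phi -> Phi 0 = 0.
Proof.
move=> h; have := h 1 0 0; rewrite !scale1r addr0.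
by move=> /(congr1 (fun Y => Y - Phi 0)); rewrite subrr addrK => <-.
Qed.

Lemma linear_map_sum d (Phi : 'M[C]_d -> 'M[C]_d) (I : finType) c X :
  is_linear_map Phi ->
  Phi (\sum_(i : I) c i *: X i) = \sum_i c i *: Phi (X i).
Proof.
move=> h; elim: (index_enum I) => [|i s ih]; first by rewrite !big_nil linear_map0.
by rewrite !big_cons h ih.
Qed.

Lemma matrix_pair_delta d (X : 'M[C]_d) :
  X = \sum_(p : 'I_d * 'I_d) X p.1 p.2 *: delta_mx p.1 p.2.
Proof. by rewrite {1}(matrix_sum_delta X) pair_bigA. Qed.

(** This block matrix is the rank one operator of the vector \sum_i e_i (x) e_i, so its form is the
    squared modulus of \sum_i v_i(i). *)
Lemma block_psd_delta d : @block_psd R d d (fun i j => delta_mx i j).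
Proof.
move=> v.
have -> : \sum_(i < d) \sum_(j < d) ((v i)^h *m delta_mx i j *m v j) 0 0 =
    conjc (\sum_i v i i 0) * \sum_j v j j 0.
  rewrite rmorph_sum mulr_suml; apply: eq_bigr => i _.
  rewrite mulr_sumr; apply: eq_bigr => j _.
  rewrite mxE (bigD1 j) //= big1 ?addr0 => [|k kj]; last first.
    rewrite mxE big1 ?mul0r // => l _; rewrite !mxE (negPf kj) andbF mulr0 //.
  rewrite mxE (bigD1 i) //= big1 ?addr0 => [|k kj]; last first.
    by rewrite !mxE (negPf kj) mulr0.
  by rewrite !mxE !eqxx mulr1.
by rewrite mulrC mulcJ_ge0.
Qed.

Definition kraus d (I : finType) (K : I -> 'M[C]_d) (X : 'M[C]_d) : 'M[C]_d :=
  \sum_k (K k)^h *m X *m K k.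

(** Choi's argument: complete positivity, applied at level k = d to the block matrix of matrix
    units, makes the Choi matrix [P] positive. Each row of a Gram factor of [P], reshaped into a
    square matrix, is a Kraus operator. *)
Theorem kraus_decomposition d (Phi : 'M[C]_d -> 'M[C]_d) :
  is_linear_map Phi -> completely_positive Phi ->
  exists (p : nat) (K : 'I_p -> 'M[C]_d), Phi =1 kraus K.
Proof.
move=> lin cp; pose I : finType := ('I_d * 'I_d)%type.
pose P : 'M[C]_#|I| := \matrix_(p, q)
  Phi (delta_mx (enum_val p : I).1 (enum_val q : I).1) (enum_val p : I).2 (enum_val q : I).2.
have PE i a j b : P (enum_rank (i, a)) (enum_rank (j, b)) = Phi (delta_mx i j) a b.
  by rewrite mxE !enum_rankK.
have sumI (G : 'I_#|I| -> C) : \sum_p G p = \sum_i \sum_a G (enum_rank (i, a)).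
  rewrite (reindex (@enum_rank I)) /=; last exact/onW_bij/enum_rank_bij.
  by rewrite pair_bigA /=; apply: eq_bigr => -[i a] _.
have hP : psd P.
  move=> x; have := cp d _ (@block_psd_delta d) (fun i => \col_a x (enum_rank (i, a)) 0).
  congr (0 <= _); rewrite mxE sumI exchange_big; apply: eq_bigr => j _.
  under [RHS]eq_bigr do rewrite mxE sumI big_distrl /=.
  rewrite exchange_big; apply: eq_bigr => i _.
  rewrite mxE; apply: eq_bigr => b _.
  rewrite !mxE; congr (_ * _); apply: eq_bigr => a _.
  by rewrite !mxE !enum_rankK.
have [B eB] := psd_gram hP.
exists #|I|, (fun k => \matrix_(i, a) B k (enum_rank (i, a))) => X.
rewrite {1}(matrix_pair_delta X) linear_map_sum //.
apply/matrixP => a b; rewrite /kraus !summxE.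
under eq_bigr => p _ do rewrite mxE -PE eB mxE mulr_sumr.
rewrite exchange_big; apply: eq_bigr => k _.
rewrite mxE -(pair_bigA _ (fun i j =>
  X i j * (B^h (enum_rank (i, a)) k * B k (enum_rank (j, b))))) exchange_big.
apply: eq_bigr => j _; rewrite mxE big_distrl /=; apply: eq_bigr => i _.
by rewrite !mxE mulrCA mulrA.
Qed.

Lemma kraus_linear d (I : finType) (K : I -> 'M[C]_d) : is_linear_map (kraus K).
Proof.
move=> a X Y; rewrite /kraus scaler_sumr -big_split; apply: eq_bigr => k _.
by rewrite mulmxDr mulmxDl -scalemxAr -scalemxAl.
Qed.

Lemma kraus_unital d (I : finType) (K : I -> 'M[C]_d) :
  unital (kraus K) -> \sum_k (K k)^h *m K k = 1%:M.
Proof. by rewrite /unital /kraus => e; rewrite -e; apply: eq_bigr => k _; rewrite mulmx1. Qed.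

Lemma kraus_trace d (I : finType) (K : I -> 'M[C]_d) :
  trace_preserving (kraus K) -> \sum_k K k *m (K k)^h = 1%:M.
Proof.
move=> tp; apply: hs_nondeg => Z.
rewrite hs_sumr {2}/hs mulmx1 -tp /kraus raddf_sum; apply: eq_bigr => k _.
by rewrite /hs mulmxA mxtrace_mulC mulmxA.
Qed.

Lemma kraus_adj d (I : finType) (K : I -> 'M[C]_d) X : kraus K X^h = (kraus K X)^h.
Proof.
rewrite /kraus mxadj_sum; apply: eq_bigr => k _.
by rewrite !mxadjM mxadjK mulmxA.
Qed.

Lemma tr_kraus d (I : finType) (K : I -> 'M[C]_d) X :
  \sum_k K k *m (K k)^h = 1%:M -> \tr (kraus K X) = \tr X.
Proof.
move=> h; rewrite /kraus raddf_sum -[X in \tr X]mulmx1 -h mulmx_sumr raddf_sum.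
by apply: eq_bigr => k _ /=; rewrite mulmxA [RHS]mxtrace_mulC mulmxA.
Qed.

(** Expanding the squares gives four sums. The first is |X|^2 by trace preservation, the last is
    |Y|^2 by unitality, and both mixed ones are |Y|^2 by the definition of Y. *)
Lemma kraus_defect d (I : finType) (K : I -> 'M[C]_d) X :
  \sum_k (K k)^h *m K k = 1%:M -> \sum_k K k *m (K k)^h = 1%:M ->
  \sum_k sqnorm (X *m K k - K k *m kraus K X) = sqnorm X - sqnorm (kraus K X).
Proof.
move=> hu ht; set Y := kraus K X; apply: complexI.
rewrite rmorph_sum rmorphB /= !sqnormE.
have e1 : \sum_k hs (X *m K k) (X *m K k) = hs X X.
  rewrite [RHS]/hs -(tr_kraus _ ht) /kraus raddf_sum; apply: eq_bigr => k _.
  by rewrite /hs mxadjM !mulmxA.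
have e2 : \sum_k hs (X *m K k) (K k *m Y) = hs Y Y.
  rewrite [RHS]/hs {2}/Y -kraus_adj /kraus mulmx_suml raddf_sum; apply: eq_bigr => k _.
  by rewrite /hs mxadjM !mulmxA.
have e3 : \sum_k hs (K k *m Y) (X *m K k) = hs Y Y.
  by rewrite -[RHS]hs_conj -e2 rmorph_sum; apply: eq_bigr => k _ /=; rewrite hs_conj.
have e4 : \sum_k hs (K k *m Y) (K k *m Y) = hs Y Y.
  have -> : hs Y Y = \tr (Y^h *m (1%:M *m Y)) by rewrite mul1mx.
  rewrite -hu mulmx_suml mulmx_sumr raddf_sum.
  by apply: eq_bigr => k _; rewrite /hs mxadjM !mulmxA.
transitivity (\sum_k hs (X *m K k) (X *m K k) - \sum_k hs (X *m K k) (K k *m Y)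
   - (\sum_k hs (K k *m Y) (X *m K k) - \sum_k hs (K k *m Y) (K k *m Y))); last first.
  by rewrite e1 e2 e3 e4 subrr subr0.
rewrite -!sumrB; apply: eq_bigr => k _.
by rewrite sqnormE hsBl !hsBr.
Qed.

Lemma kraus_contraction d (I : finType) (K : I -> 'M[C]_d) X :
  \sum_k (K k)^h *m K k = 1%:M -> \sum_k K k *m (K k)^h = 1%:M ->
  sqnorm (kraus K X) <= sqnorm X.
Proof.
move=> hu ht; rewrite -subr_ge0 -kraus_defect //.
by apply: sumr_ge0 => k _; exact: sqnorm_ge0.
Qed.

(** Trades a quadratic condition on X for one linear in X, which is what makes norm preservation cut
    out a subspace. *)
Lemma kraus_isometryP d (I : finType) (K : I -> 'M[C]_d) X :
  \sum_k (K k)^h *m K k = 1%:M -> \sum_k K k *m (K k)^h = 1%:M ->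
  (sqnorm (kraus K X) = sqnorm X) <-> (forall k, X *m K k = K k *m kraus K X).
Proof.
move=> hu ht; split=> [e k|e]; last first.
  apply/eqP; rewrite eq_sym -subr_eq0 -kraus_defect // big1 // => k _.
  by rewrite -e subrr sqnorm_0.
have /eqP : \sum_k sqnorm (X *m K k - K k *m kraus K X) = 0 by rewrite kraus_defect // e subrr.
rewrite psumr_eq0 => [|i _]; last exact: sqnorm_ge0.
move=> /allP /(_ k (mem_index_enum _)) /eqP/sqnorm_eq0/eqP.
by rewrite subr_eq0 => /eqP.
Qed.

End Kraus.

(** * Caratheodory's theorem for finite convex combinations *)

Section Caratheodory.
Variable R : realType.

(** Prefixing each vector with a coordinate 1 turns an affine dependence into an ordinary kernel
    vector. A nonzero vector with coordinate sum 0 has a positive entry. *)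
Lemma affine_dependence n l (v : 'I_l -> 'rV[R]_n) : (n.+1 < l)%N ->
  exists c : 'I_l -> R, [/\ exists i, 0 < c i, \sum_i c i = 0 & \sum_i c i *: v i = 0].
Proof.
move=> ln; pose M : 'M[R]_(l, 1 + n) := \matrix_i row_mx 1%:M (v i).
have kn : kermx M != 0.
  rewrite kermx_eq0 /row_free neq_ltn; apply/orP; left.
  exact: leq_ltn_trans (rank_leq_col M) ln.
have [r hr] := rowV0Pn kn; case => cn0.
have /sub_kermxP cM : (r <= kermx M)%MS by [].
have sumE : \sum_i r 0 i *: row i M = 0 by rewrite -mulmx_sum_row.
have s0 : \sum_i r 0 i = 0.
  have := congr1 (fun m : 'rV_(1 + n) => lsubmx m 0 0) sumE.
  rewrite linear_sum summxE linear0 [RHS]mxE => e; rewrite -[RHS]e.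
  by apply: eq_bigr => i _; rewrite linearZ /= rowK row_mxKl !mxE mulr1.
have s1 : \sum_i r 0 i *: v i = 0.
  have := congr1 (fun m : 'rV_(1 + n) => rsubmx m) sumE.
  rewrite linear_sum linear0 => e; rewrite -[RHS]e.
  by apply: eq_bigr => i _; rewrite linearZ /= rowK row_mxKr.
exists (r 0); split=> //; apply: contrapT => /forallNP neg.
have le0 i : r 0 i <= 0 by rewrite leNgt; apply/negP; exact: neg.
have : \sum_i (- r 0 i) = 0 by rewrite sumrN s0 oppr0.
move/eqP; rewrite psumr_eq0 => [/allP h|i _]; last by rewrite oppr_ge0.
move/eqP: cn0; apply; apply/rowP => i; rewrite mxE.
by apply/eqP; rewrite -oppr_eq0; exact: (h i (mem_index_enum i)).
Qed.

(** The number of terms is exactly n + 1, whatever l is, so that whole sequences of convex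
    combinations share one index set. *)
Lemma caratheodory n l (v : 'I_l -> 'rV[R]_n) (lam : 'I_l -> R) :
  (forall i, 0 <= lam i) -> \sum_i lam i = 1 ->
  exists (f : 'I_n.+1 -> 'I_l) (mu : 'I_n.+1 -> R),
    [/\ forall k, 0 <= mu k, \sum_k mu k = 1 &
        \sum_k mu k *: v (f k) = \sum_i lam i *: v i].
Proof.
elim: l v lam => [|l ih] v lam lam0 lam1.
  by move/eqP: lam1; rewrite big_ord0 eq_sym oner_eq0.
have [ln|ln] := leqP l.+1 n.+1.
  (* With at most n + 1 points, the surplus indices get weight 0 and the dummy point [ord0]. *)
  pose mu k := if insub k is Some j then lam j else 0 : R.
  pose f k := if insub k is Some j then j else ord0 : 'I_l.+1.
  have sumE (V : lmodType R) (w : 'I_l.+1 -> V) :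
      \sum_(k < n.+1) mu k *: w (f k) = \sum_i lam i *: w i.
    rewrite [LHS](bigID (fun k : 'I_n.+1 => (k < l.+1)%N)) /= [X in _ + X]big1 ?addr0.
      rewrite (big_ord_narrow ln) /=; apply: eq_bigr => i _.
      by rewrite /mu /f /= valK.
    by move=> k lk; rewrite /mu insubN ?scale0r.
  exists (fun k => f k), (fun k => mu k); split.
  - by move=> k; rewrite /mu; case: insub.
  - have : \sum_(k < n.+1) mu k * 1 = \sum_i lam i * 1 := sumE R^o (fun=> 1).
    by rewrite -!mulr_suml !mulr1 lam1.
  - exact: sumE.
have [c [[i1 ci1] c0 cv0]] := affine_dependence v ln.
have [i0 ci0 hmin] : exists2 i0, 0 < c i0 & forall i, 0 < c i -> lam i0 / c i0 <= lam i / c i.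
  have [i0 h1 h2] := @Order.TotalTheory.arg_minP _ _ _ i1
    (fun i => 0 < c i) (fun i => lam i / c i) ci1.
  by exists i0.
(* The largest multiple of the dependence that can be subtracted while all weights stay nonnegative;
   it makes the weight at [i0] vanish, so the induction hypothesis applies. *)
pose t := lam i0 / c i0.
have t0 : 0 <= t by rewrite divr_ge0 // ltW.
pose lam' i := lam i - t * c i.
have lam'0 i : 0 <= lam' i.
  rewrite subr_ge0; have [ci|ci] := ltP 0 (c i); first by rewrite -ler_pdivlMr // hmin.
  by apply: le_trans (lam0 i); rewrite mulr_ge0_le0.
have lam'i0 : lam' i0 = 0 by rewrite /lam' /t divfK ?subrr // gt_eqF.
have s1 : \sum_i lam' i = 1 by rewrite sumrB -mulr_sumr c0 mulr0 subr0.
have sv : \sum_i lam' i *: v i = \sum_i lam i *: v i.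
  under eq_bigr do rewrite scalerBl -scalerA.
  by rewrite sumrB -scaler_sumr cv0 scaler0 subr0.
have [|f [mu [mu0 mu1 muv]]] := ih (v \o lift i0) (lam' \o lift i0) (fun i => lam'0 _).
  by rewrite -s1 (bigD1_ord i0) //= lam'i0 add0r.
exists (lift i0 \o f), mu; split=> //.
by rewrite -sv (bigD1_ord i0) //= lam'i0 scale0r add0r -muv.
Qed.

End Caratheodory.

(** * Convex combinations of conjugations by a set of unitaries *)

Section Mixed.
Variables (R : realType) (d : nat).
Local Notation C := R[i].
Implicit Types (G : 'M[C]_d -> Prop) (X Y U V : 'M[C]_d).

(** The set G is a parameter because the interior argument takes place in the unitary group of a
    commutant. For [G := @unitary_mx R d] this is [mixed_unitary] up to conversion. *)
Definition mixed G (Phi : 'M[C]_d -> 'M[C]_d) : Prop :=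
  exists (l : nat) (lam : 'I_l -> R) (U : 'I_l -> 'M[C]_d),
    [/\ forall j, 0 <= lam j, \sum_(j < l) lam j = 1,
        forall j, G (U j)
      & forall X, Phi X = \sum_(j < l) (lam j)%:C%C *: Ad (U j) X].

Lemma AdM U V X : Ad U (Ad V X) = Ad (V *m U) X.
Proof. by rewrite /Ad mxadjM !mulmxA. Qed.

Lemma Ad_linear U : is_linear_map (Ad U).
Proof. by move=> a X Y; rewrite /Ad mulmxDr mulmxDl -scalemxAr -scalemxAl. Qed.

Lemma Ad_sum U (I : finType) (c : I -> C) (X : I -> 'M[C]_d) :
  Ad U (\sum_i c i *: X i) = \sum_i c i *: Ad U (X i).
Proof. exact/linear_map_sum/Ad_linear. Qed.

Lemma Ad_adj U X : Ad U X^h = (Ad U X)^h.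
Proof. by rewrite /Ad !mxadjM mxadjK mulmxA. Qed.

Lemma Ad_hs U X Y : hs (Ad U X) Y = hs X (Ad U^h Y).
Proof.
by rewrite /hs /Ad !mxadjM !mxadjK -!mulmxA mxtrace_mulC !mulmxA.
Qed.

Lemma Ad_unitaryK U : unitary_mx U -> cancel (Ad U) (Ad U^h).
Proof.
by move=> /unitary_mxE hU X; rewrite AdM hU /Ad mxadj1 mul1mx mulmx1.
Qed.

Lemma Ad_sqnorm U X : unitary_mx U -> sqnorm (Ad U X) = sqnorm X.
Proof. by move=> hU; apply: complexI; rewrite !sqnormE Ad_hs Ad_unitaryK. Qed.

Lemma Ad_comm U X : unitary_mx U -> Ad U X = X <-> U *m X = X *m U.
Proof.
move=> hU; rewrite /Ad; split=> [e|e].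
  by rewrite -{1}e !mulmxA (unitary_mxE hU) mul1mx.
by rewrite -mulmxA -e mulmxA hU mul1mx.
Qed.

Lemma sqnorm_unitary U : unitary_mx U -> sqnorm U = d%:R.
Proof. by move=> hU; apply: complexI; rewrite sqnormE /hs hU mxtrace1 rmorph_nat. Qed.

Lemma mixed_fin G Phi (I : finType) (lam : I -> R) (U : I -> 'M[C]_d) :
  (forall j, 0 <= lam j) -> \sum_j lam j = 1 -> (forall j, G (U j)) ->
  (forall X, Phi X = \sum_j (lam j)%:C%C *: Ad (U j) X) -> mixed G Phi.
Proof.
move=> h0 h1 hG hPhi.
exists #|I|, (lam \o enum_val), (U \o enum_val); split=> //= [|X].
  by rewrite -h1 [RHS](reindex (@enum_val I I)) //; exact/onW_bij/enum_val_bij.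
by rewrite hPhi [LHS](reindex (@enum_val I I)) //; exact/onW_bij/enum_val_bij.
Qed.

Lemma mixed_ext G Phi Psi : Phi =1 Psi -> mixed G Phi -> mixed G Psi.
Proof.
by move=> e [l [lam [U [h0 h1 hG hP]]]]; exists l, lam, U; split=> // X; rewrite -e.
Qed.

Lemma mixed_sub G G' Phi : (forall U, G U -> G' U) -> mixed G Phi -> mixed G' Phi.
Proof.
by move=> s [l [lam [U [h0 h1 hG hP]]]]; exists l, lam, U; split=> // j; exact/s.
Qed.

Lemma mixed_Ad G U : G U -> mixed G (Ad U).
Proof.
move=> hU; apply: (@mixed_fin _ _ 'I_1 (fun=> 1) (fun=> U)) => //.
  by rewrite big_ord1.
by move=> X; rewrite big_ord1 scale1r.
Qed.

Lemma mixed_comp G Phi Psi : (forall U V, G U -> G V -> G (U *m V)) ->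
  mixed G Phi -> mixed G Psi -> mixed G (Phi \o Psi).
Proof.
move=> GM [l [lam [U [h0 h1 hG hP]]]] [k [mu [V [g0 g1 gG gP]]]].
apply: (@mixed_fin _ _ ('I_l * 'I_k)%type (fun p => lam p.1 * mu p.2)
  (fun p => V p.2 *m U p.1)) => [p||p|X].
- exact: mulr_ge0.
- rewrite -(pair_bigA _ (fun i j => lam i * mu j)) /=.
  by under eq_bigr do rewrite -mulr_sumr g1 mulr1.
- exact: GM.
- rewrite -(pair_bigA _ (fun i j => (lam i * mu j)%:C%C *: Ad (V j *m U i) X)) /=.
  rewrite hP; apply: eq_bigr => i _; rewrite gP Ad_sum scaler_sumr.
  by apply: eq_bigr => j _; rewrite AdM scalerA -rmorphM.
Qed.

Lemma mixed_mid G Phi Psi : mixed G Phi -> mixed G Psi ->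
  mixed G (fun X => (2^-1 : R)%:C%C *: (Phi X + Psi X)).
Proof.
move=> [l [lam [U [h0 h1 hG hP]]]] [k [mu [V [g0 g1 gG gP]]]].
apply: (@mixed_fin _ _ ('I_l + 'I_k)%type
  (fun p => match p with inl i => 2^-1 * lam i | inr j => 2^-1 * mu j end)
  (fun p => match p with inl i => U i | inr j => V j end)).
- by case=> i; rewrite mulr_ge0 ?invr_ge0.
- by rewrite big_sumType /= -!mulr_sumr h1 g1; lra.
- by case.
- move=> X; rewrite hP gP scalerDr !scaler_sumr big_sumType /=.
  by congr (_ + _); apply: eq_bigr => i _; rewrite scalerA -rmorphM.
Qed.

Lemma linear_map_ext (Phi Psi : 'M[C]_d -> 'M[C]_d) :
  is_linear_map Phi -> is_linear_map Psi ->
  (forall i j, Phi (delta_mx i j) = Psi (delta_mx i j)) -> Phi =1 Psi.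
Proof.
move=> h1 h2 e X; rewrite (matrix_pair_delta X) !linear_map_sum //.
by apply: eq_bigr => p _; rewrite e.
Qed.

Lemma sum_linear (I : finType) (c : I -> C) (F : I -> 'M[C]_d -> 'M[C]_d) :
  (forall i, is_linear_map (F i)) -> is_linear_map (fun X => \sum_i c i *: F i X).
Proof.
move=> h a X Y; rewrite scaler_sumr -big_split; apply: eq_bigr => i _.
by rewrite h scalerDr !scalerA [a * _]mulrC.
Qed.

(* one more than the number of real coordinates of a linear map on M_d (Caratheodory) *)
Definition mixed_card : nat := #|{: ('I_d * 'I_d) * ('I_d * 'I_d) * bool}|.+1.

(** A linear map is determined by the real and imaginary parts of its entries on matrix units, so
    Caratheodory applies in that real space. The bound is uniform in Phi, as a compactness argument
    requires. *)
Lemma mixed_bounded G Phi : mixed G Phi ->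
  exists (lam : 'I_mixed_card -> R) (U : 'I_mixed_card -> 'M[C]_d),
    [/\ forall j, 0 <= lam j, \sum_j lam j = 1,
        forall j, G (U j)
      & forall X, Phi X = \sum_j (lam j)%:C%C *: Ad (U j) X].
Proof.
move=> [l [lam [U [h0 h1 hG hP]]]].
pose I : finType := (('I_d * 'I_d) * ('I_d * 'I_d) * bool)%type.
pose ent (Y : C) (b : bool) : R := if b then complex.Re Y else complex.Im Y.
pose v j : 'rV[R]_#|I| := \row_p
  let q : I := enum_val p in
  ent (Ad (U j) (delta_mx q.1.1.1 q.1.1.2) q.1.2.1 q.1.2.2) q.2.
have [f [mu [mu0 mu1 e]]] := caratheodory v h0 h1.
exists mu, (U \o f); split=> //= X; rewrite hP.
move: X; apply: linear_map_ext; try by apply: sum_linear => i; exact: Ad_linear.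
move=> i j; apply/matrixP => a b.
have ent_sum (K : finType) (c : K -> R) (z : K -> C) t :
    ent (\sum_k (c k)%:C%C * z k) t = \sum_k c k * ent (z k) t.
  elim: (index_enum K) => [|k s ih]; first by rewrite !big_nil; case: t.
  rewrite !big_cons -ih; case: t {ih} => /=; rewrite raddfD /= ?ReM ?ImM /=; ring.
have E t : ent (\sum_k (mu k)%:C%C * Ad (U (f k)) (delta_mx i j) a b) t =
           ent (\sum_k (lam k)%:C%C * Ad (U k) (delta_mx i j) a b) t.
  rewrite !ent_sum.
  have := congr1 (fun w : 'rV[R]_#|I| => w 0 (enum_rank ((i, j), (a, b), t))) e.
  rewrite !summxE; under eq_bigr do rewrite !mxE enum_rankK /=.
  by under [in RHS]eq_bigr do rewrite !mxE enum_rankK /=.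
rewrite !summxE; under eq_bigr do rewrite mxE; under [RHS]eq_bigr do rewrite mxE.
have := E true; have := E false; rewrite /ent => e1 e2.
by apply/esym/eqP; rewrite eq_complex e1 e2 !eqxx.
Qed.

Section Closed.
Variable F : set_system nat.
Context {FU : UltraFilter F}.

Definition ultra_closed G := forall (u : nat -> 'M[C]_d) a,
  (forall n, G (u n)) -> mcvg F u a -> G a.

Lemma unitary_ultra_closed : ultra_closed (@unitary_mx R d).
Proof.
move=> u a hu ua.
have h : mcvg F (fun k => (u k)^h *m u k) (a^h *m a) by apply: mcvgM => //; exact: mcvg_adj.
apply: mcvg_uniq h _; rewrite (_ : (fun _ => _) = fun=> 1%:M); first exact: mcvg_cst.
exact/funext.
Qed.

Lemma mcvg_Ad (u : nat -> 'M[C]_d) (X : nat -> 'M[C]_d) a Y :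
  mcvg F u a -> mcvg F X Y -> mcvg F (fun k => Ad (u k) (X k)) (Ad a Y).
Proof. by move=> ua xy; apply: mcvgM => //; apply: mcvgM => //; exact: mcvg_adj. Qed.

(** With a fixed number of terms, the weights stay in [0, 1] and the unitaries have constant norm,
    so all of them converge along F at once; their limits give a decomposition of Psi. *)
Theorem mixed_closed G (Phi : nat -> 'M[C]_d -> 'M[C]_d) Psi :
  (forall U, G U -> unitary_mx U) -> ultra_closed G ->
  (forall n, mixed G (Phi n)) ->
  (forall X, mcvg F (fun n => Phi n X) (Psi X)) -> mixed G Psi.
Proof.
move=> GU Gc hm hcv.
have hb n := mixed_bounded (hm n).
pose lam n := projT1 (cid (hb n)).
pose U n := projT1 (cid (projT2 (cid (hb n)))).
have P n : [/\ forall j, 0 <= lam n j, \sum_j lam n j = 1, forall j, G (U n j)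
      & forall X, Phi n X = \sum_j (lam n j)%:C%C *: Ad (U n j) X].
  exact: (projT2 (cid (projT2 (cid (hb n))))).
have lam_le n j : lam n j <= 1.
  have [h0 <- _ _] := P n; rewrite (bigD1 j) //= lerDl; exact: sumr_ge0.
have hl j : exists l : R, (fun n => lam n j) @ F --> l.
  apply: (@ultra_bounded_cvg _ _ _ _ 1) => n.
  by have [h0 _ _ _] := P n; rewrite ger0_norm.
have hU j : exists a, mcvg F (fun n => U n j) a.
  apply: (@mcvg_bounded _ _ _ _ _ _ d%:R) => n.
  by have [_ _ hG _] := P n; rewrite sqnorm_unitary //; exact/GU.
pose l j := projT1 (cid (hl j)).
pose V j := projT1 (cid (hU j)).
have cl j : (fun n => lam n j) @ F --> l j := projT2 (cid (hl j)).
have cV j : mcvg F (fun n => U n j) (V j) := projT2 (cid (hU j)).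
apply: (@mixed_fin _ _ _ l V) => [j||j|X].
- by apply: (ultra_cvg_ge _ (cl j)) => n; have [h0 _ _ _] := P n.
- have h : ccvg F (fun n => \sum_j (lam n j)%:C%C) (\sum_j (l j)%:C%C).
    by apply: ccvg_sum => j; exact: ccvg_real.
  apply: complexI; rewrite rmorph_sum; apply: ccvg_uniq h _.
  rewrite (_ : (fun _ => _) = fun=> 1%:C%C); first exact: ccvg_cst.
  by apply/funext => n /=; have [_ <- _ _] := P n; rewrite rmorph_sum.
- by apply: Gc (cV j) => n; have [_ _ hG _] := P n.
- apply: mcvg_uniq (hcv X) _.
  rewrite [Z in mcvg _ Z _](_ : _ = fun n => \sum_j (lam n j)%:C%C *: Ad (U n j) X).
    apply: mcvg_sum => j; apply: mcvgZ; first exact/ccvg_real/cl.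
    by apply: mcvg_Ad => //; exact: mcvg_cst.
  by apply/funext => n; have [_ _ _ ->] := P n.
Qed.

End Closed.
End Mixed.

(** * The mean over a closed group of unitaries *)

Section Mean.
Variables (R : realType) (d : nat).
Local Notation C := R[i].
Implicit Types (X Y U V : 'M[C]_d).

Lemma mixed_linear (G : 'M[C]_d -> Prop) Phi : mixed G Phi -> is_linear_map Phi.
Proof.
move=> [l [lam [U [_ _ _ e]]]] a X Y; rewrite !e.
have := @sum_linear R d _ (fun j => (lam j)%:C%C) (fun j => Ad (U j)).
by move=> h; apply: h => j; exact: Ad_linear.
Qed.

Lemma mixed_kraus (G : 'M[C]_d -> Prop) Phi : (forall U, G U -> unitary_mx U) -> mixed G Phi ->
  exists (l : nat) (K : 'I_l -> 'M[C]_d), [/\ Phi =1 kraus K,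
    \sum_k (K k)^h *m K k = 1%:M & \sum_k K k *m (K k)^h = 1%:M].
Proof.
move=> GU [l [lam [U [h0 h1 hG e]]]].
have sq j : (Num.sqrt (lam j))%:C%C * (Num.sqrt (lam j))%:C%C = (lam j)%:C%C :> C.
  by rewrite -rmorphM -expr2 sqr_sqrtr.
exists l, (fun j => (Num.sqrt (lam j))%:C%C *: U j); split.
- move=> X; rewrite e; apply: eq_bigr => j _.
  by rewrite mxadjZ conjc_real -!scalemxAl -scalemxAr scalerA sq.
- transitivity (\sum_j (lam j)%:C%C *: (1%:M : 'M[C]_d)).
    apply: eq_bigr => j _.
    by rewrite mxadjZ conjc_real -!scalemxAl -scalemxAr scalerA sq (GU _ (hG j)).
  by rewrite -scaler_suml -rmorph_sum h1 scale1r.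
- transitivity (\sum_j (lam j)%:C%C *: (1%:M : 'M[C]_d)).
    apply: eq_bigr => j _.
    by rewrite mxadjZ conjc_real -!scalemxAl -scalemxAr scalerA sq (unitary_mxE (GU _ (hG j))).
  by rewrite -scaler_suml -rmorph_sum h1 scale1r.
Qed.

Lemma mixed_contraction (G : 'M[C]_d -> Prop) Phi X :
  (forall U, G U -> unitary_mx U) -> mixed G Phi -> sqnorm (Phi X) <= sqnorm X.
Proof.
by move=> GU hm; have [l [K [e hu ht]]] := mixed_kraus GU hm; rewrite e kraus_contraction.
Qed.

Definition super_sqnorm (Phi : 'M[C]_d -> 'M[C]_d) : R :=
  \sum_i \sum_j sqnorm (Phi (delta_mx i j)).

Lemma super_sqnorm_eq0 Phi Psi : is_linear_map Phi -> is_linear_map Psi ->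
  super_sqnorm (fun X => Phi X - Psi X) <= 0 -> Phi =1 Psi.
Proof.
move=> h1 h2 le0; apply: linear_map_ext => // i j.
apply/eqP; rewrite -subr_eq0; apply/eqP/sqnorm_eq0/le_anti; rewrite sqnorm_ge0 andbT.
apply: le_trans le0; rewrite /super_sqnorm (bigD1 i) //= (bigD1 j) //= -addrA lerDl addr_ge0 //.
  by apply: sumr_ge0 => ? _; exact: sqnorm_ge0.
by do 2 (apply: sumr_ge0 => ? _); exact: sqnorm_ge0.
Qed.

Variable G : 'M[C]_d -> Prop.
Hypothesis GU : forall U, G U -> unitary_mx U.
Hypothesis G1 : G 1%:M.
Hypothesis GM : forall U V, G U -> G V -> G (U *m V).
Hypothesis GV : forall U, G U -> G U^h.
Hypothesis Gc : forall F : set_system nat, UltraFilter F -> ultra_closed F G.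

(** A minimising sequence, within 1/(n+1) of the infimum, consists of contractions and hence has a
    pointwise limit along the ultrafilter; closedness keeps this limit in the set. *)
Lemma min_super_sqnorm : exists2 E, mixed G E &
  forall Phi, mixed G Phi -> super_sqnorm E <= super_sqnorm Phi.
Proof.
have [F [FU sF]] := nonprincipal_ultra.
pose S : set R := [set r | exists2 Phi, mixed G Phi & r = super_sqnorm Phi].
have hS : has_inf S.
  split; first by exists (super_sqnorm (Ad 1%:M)), (Ad 1%:M) => //; exact: mixed_Ad.
  by exists 0 => _ [Phi _ ->]; do 2 (apply: sumr_ge0 => ? _); exact: sqnorm_ge0.
have hn n : exists Phi, mixed G Phi /\ super_sqnorm Phi < inf S + harmonic n.
  have [_ [Phi hm ->] lt] := @inf_adherent _ S (@harmonic R n) (harmonic_gt0 n) hS.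
  by exists Phi.
pose Phi n := projT1 (cid (hn n)).
have hm n : mixed G (Phi n) by have [] := projT2 (cid (hn n)).
have hlt n : super_sqnorm (Phi n) < inf S + harmonic n by have [] := projT2 (cid (hn n)).
have hE X : exists Y, mcvg F (fun n => Phi n X) Y.
  by apply: (@mcvg_bounded _ _ _ _ _ _ (sqnorm X)) => n; exact: (mixed_contraction _ GU).
pose E X := projT1 (cid (hE X)).
have cE X : mcvg F (fun n => Phi n X) (E X) := projT2 (cid (hE X)).
have mE : mixed G E by exact: (mixed_closed GU (Gc FU) hm cE).
exists E => // Psi mPsi; apply: le_trans (_ : inf S <= _); last first.
  by apply: ge_inf; [case: hS|exists Psi].
have cvS : (fun n => super_sqnorm (Phi n) - harmonic n) @ F --> super_sqnorm E - 0.
  apply: cvgB; last by apply: eventually_ultra => //; exact: cvg_harmonic.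
  rewrite /super_sqnorm.
  by apply: real_cvg_sum => i; apply: real_cvg_sum => j; apply: sqnorm_cvg; exact: cE.
rewrite -[X in X <= _]subr0; apply: (ultra_cvg_le _ cvS) => n.
by rewrite lerBlDr ltW.
Qed.

(* E is the point of least Hilbert-Schmidt norm in the compact convex set
   conv {Ad U : U in G}; as left translations preserve this set and the norm,
   uniqueness of E gives its invariance. *)
Theorem group_mean : exists E, [/\ mixed G E,
  forall U X, G U -> Ad U (E X) = E X,
  forall U X, G U -> E (Ad U X) = E X &
  forall X Y, hs (E X) Y = hs X (E Y)].
Proof.
have [E mE minE] := min_super_sqnorm.
have linE := mixed_linear mE.
have uniq Phi : mixed G Phi -> super_sqnorm Phi <= super_sqnorm E -> Phi =1 E.
  move=> mP leP; apply: super_sqnorm_eq0 => //; first exact: mixed_linear mP.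
  (* By the parallelogram law, minimality of E against the midpoint of Phi and E forces |Phi - E|^2
     <= 0. *)
  have := minE _ (mixed_mid mP mE).
  have -> : super_sqnorm (fun X => (2^-1 : R)%:C%C *: (Phi X + E X)) =
      4^-1 * super_sqnorm (fun X => Phi X + E X).
    rewrite /super_sqnorm mulr_sumr; apply: eq_bigr => i _; rewrite mulr_sumr.
    apply: eq_bigr => j _; apply: complexI; rewrite rmorphM /= !sqnormE hsZl hsZr.
    by rewrite conjc_real mulrA -rmorphM /=; congr (_%:C%C * _); lra.
  have : super_sqnorm (fun X => Phi X + E X) + super_sqnorm (fun X => Phi X - E X) =
      2 * super_sqnorm Phi + 2 * super_sqnorm E.
    rewrite /super_sqnorm !mulr_sumr -!big_split; apply: eq_bigr => i _ /=.
    rewrite !mulr_sumr -!big_split; apply: eq_bigr => j _ /=.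
    exact: sqnorm_parallelogram.
  by lra.
have left_inv U X : G U -> Ad U (E X) = E X.
  move=> hU; apply: (uniq (Ad U \o E)).
    by apply: mixed_comp => //; exact: mixed_Ad.
  rewrite /super_sqnorm; apply: ler_sum => i _; apply: ler_sum => j _ /=.
  by rewrite Ad_sqnorm //; exact: GU.
have [l [lam [U [h0 h1 hG e]]]] := mE.
(* [E'] is the Hilbert-Schmidt adjoint of E. Left invariance of E becomes right invariance of [E'],
   and evaluating [E' (E X)] in both ways gives E = E'. So E is self-adjoint and invariant on both
   sides. *)
pose E' X := \sum_(j < l) (lam j)%:C%C *: Ad (U j)^h X.
have adjE X Y : hs (E X) Y = hs X (E' Y).
  rewrite e hs_suml hs_sumr; apply: eq_bigr => j _.
  by rewrite hsZl hsZr conjc_real Ad_hs.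
have right_inv V X : G V -> E' (Ad V X) = E' X.
  move=> hV; apply: hs_nondeg => Z.
  rewrite -!adjE; have := Ad_hs V^h (E Z) X.
  by rewrite mxadjK left_inv; [move=> <-|exact: GV].
have EE' : E =1 E'.
  move=> X; transitivity (E' (E X)).
    transitivity (\sum_(j < l) (lam j)%:C%C *: E X).
      by rewrite -scaler_suml -rmorph_sum h1 scale1r.
    by apply: eq_bigr => j _; rewrite left_inv //; exact: GV.
  have linE' : is_linear_map E' by apply: sum_linear => j; exact: Ad_linear.
  rewrite e linear_map_sum //.
  transitivity (\sum_(j < l) (lam j)%:C%C *: E' X).
    by apply: eq_bigr => j _; rewrite right_inv.
  by rewrite -scaler_suml -rmorph_sum h1 scale1r.
exists E; split=> //.
- by move=> V X hV; rewrite !EE' right_inv.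
- by move=> X Y; rewrite adjE EE'.
Qed.

End Mean.

(** * The commutant of a self-adjoint set and its unitaries *)

Section Commutant.
Variables (R : realType) (d : nat).
Local Notation C := R[i].
Implicit Types (X Y U V x y : 'M[C]_d).

Variable W : 'M[C]_d -> Prop.
Hypothesis Wadj : forall X, W X -> W X^h.

Definition commutant (K : 'M[C]_d) := forall X, W X -> K *m X = X *m K.
Definition ucommutant (U : 'M[C]_d) := unitary_mx U /\ commutant U.

Local Notation A := commutant.
Local Notation G := ucommutant.

Lemma commutant1 : A 1%:M. Proof. by move=> X _; rewrite mul1mx mulmx1. Qed.

Lemma commutantM x y : A x -> A y -> A (x *m y).
Proof. by move=> hx hy X WX; rewrite -mulmxA hy // mulmxA hx // mulmxA. Qed.

Lemma commutantD x y : A x -> A y -> A (x + y).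
Proof. by move=> hx hy X WX; rewrite mulmxDl mulmxDr hx ?hy. Qed.

Lemma commutantZ a x : A x -> A (a *: x).
Proof. by move=> hx X WX; rewrite -scalemxAl -scalemxAr hx. Qed.

Lemma commutant_adj x : A x -> A x^h.
Proof.
move=> hx X WX; have := hx _ (Wadj WX) => /(congr1 (@mxadj R d d)).
by rewrite !mxadjM mxadjK => ->.
Qed.

Lemma commutant_sum (I : finType) (F : I -> 'M[C]_d) : (forall i, A (F i)) -> A (\sum_i F i).
Proof.
move=> h; apply: (big_ind A) => [X _||//]; first by rewrite mul0mx mulmx0.
exact: commutantD.
Qed.

Lemma ucommutant1 : G 1%:M. Proof. by split; [exact: unitary1|exact: commutant1]. Qed.

Lemma ucommutantM U V : G U -> G V -> G (U *m V).
Proof. by move=> [hU aU] [hV aV]; split; [exact: unitary_mul|exact: commutantM]. Qed.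

Lemma ucommutant_adj U : G U -> G U^h.
Proof. by move=> [hU aU]; split; [exact: unitary_adj|exact: commutant_adj]. Qed.

Lemma ucommutant_ultra_closed (F : set_system nat) : UltraFilter F -> ultra_closed F G.
Proof.
move=> FU u a hu ua; split; first by apply: unitary_ultra_closed ua => n; case: (hu n).
move=> X WX.
have h1 : mcvg F (fun n => u n *m X) (a *m X) by apply: mcvgM => //; exact: mcvg_cst.
have h2 : mcvg F (fun n => X *m u n) (X *m a) by apply: mcvgM => //; exact: mcvg_cst.
apply: mcvg_uniq h1 _; rewrite (_ : (fun _ => _) = fun n => X *m u n) //.
by apply/funext => n; case: (hu n) => _ ->.
Qed.

(** Rank one eigenprojections of x may fail to commute with W; projections onto full eigenspaces do
    commute, being functions of x. *)
Lemma commutant_projections x : A x -> x^h = x ->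
  exists (P : 'I_d -> 'M[C]_d) (a : 'I_d -> R),
    [/\ forall k, A (P k), forall k, (P k)^h = P k,
        forall k l, P k *m P l = if k == l then P k else 0 &
        x = \sum_k (a k)%:C%C *: P k].
Proof.
move=> hx /hermitian_spectral [Q [a [hQ e]]].
(* [r] selects one index in each class of equal eigenvalues. [P k] is the full eigenprojection if k
   is selected and 0 otherwise, which leaves the sum and the orthogonality relations correct. *)
pose r i := odflt i [pick j | a j == a i].
have ar i : a (r i) = a i.
  by rewrite /r; case: pickP => [j /eqP //|/(_ i)]; rewrite eqxx.
have rr i j : a i = a j -> r i = r j.
  move=> aij; rewrite /r (eq_pick (_ : _ =1 (fun k => a k == a j))) => [|k]; last by rewrite aij.
  by case: pickP => [//|/(_ j)]; rewrite eqxx.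
pose P k := spectral_fun Q (fun i => (r i == k)%:R).
exists P, a; split.
- move=> k X WX; apply/esym.
  apply: (@spectral_fun_comm _ _ _ _ (fun i => (a i)%:C%C)) => // [i j /complexI/rr -> //|].
  by rewrite -e hx.
- by move=> k; rewrite spectral_fun_adj; apply: eq_spectral_fun => i; rewrite rmorph_nat.
- move=> k l; rewrite spectral_funM //; case: eqP => [->|kl].
    by apply: eq_spectral_fun => i; case: eqP; rewrite ?mulr1 ?mulr0.
  transitivity (spectral_fun Q (fun=> 0)).
    apply: eq_spectral_fun => i; case: eqP => [->|]; rewrite ?mul0r //.
    by move/eqP: kl => /negPf ->; rewrite mulr0.
  rewrite /spectral_fun (_ : diag_mx _ = 0) ?mulmx0 ?mul0mx //.
  by apply/matrixP => i j; rewrite !mxE mul0rn.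
- rewrite e spectral_fun_lin; apply: eq_spectral_fun => i.
  rewrite (bigD1 (r i)) //= eqxx mulr1 ar big1 ?addr0 // => k.
  by rewrite eq_sym => /negPf ->; rewrite mulr0.
Qed.

Lemma commutant_hermitian_ind (S : 'M[C]_d -> Prop) :
  (forall a x y, S x -> S y -> S (a *: x + y)) ->
  (forall x, A x -> x^h = x -> S x) -> forall x, A x -> S x.
Proof.
move=> Slin Sh x hx.
have two : (2 : C) != 0 by rewrite pnatr_eq0.
have ii : 'i%C * 'i%C = -1 :> C by rewrite -expr2 sqr_i.
have -> : x = (2^-1 * - 'i%C) *: ('i%C *: (x - x^h)) + 2^-1 *: (x + x^h).
  rewrite scalerA -mulrA mulNr ii opprK mulr1 -scalerDr addrACA addNr addr0 -mulr2n.
  by rewrite -[x *+ 2]scaler_nat scalerA mulVf // scale1r.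
apply: Slin.
  apply: Sh.
    apply: commutantZ; rewrite -scaleN1r; apply: commutantD => //.
    exact/commutantZ/commutant_adj.
  rewrite mxadjZ mxadjB mxadjK -[x - _]opprB scalerN -scaleNr; congr (_ *: _).
  by apply/eqP; rewrite eq_complex /= oppr0 !eqxx.
apply: Sh; first by apply: commutantZ; apply: commutantD => //; exact: commutant_adj.
rewrite mxadjZ mxadjD mxadjK addrC; congr (_ *: _).
by rewrite conjc_inv conjc_nat.
Qed.

(** This element multiplies the range of P by z and fixes its orthogonal complement. *)
Lemma projection_phase P (z : C) : A P -> P^h = P -> P *m P = P -> z * conjc z = 1 ->
  G (1%:M + (z - 1) *: P).
Proof.
move=> hP Ph PP hz; split; last by apply: commutantD; [exact: commutant1|exact: commutantZ].
rewrite /unitary_mx mxadjD mxadj1 mxadjZ Ph mulmxDl mul1mx mulmxDr mulmx1.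
rewrite -scalemxAl -scalemxAr scalerA PP -addrA -[RHS]addr0; congr (_ + _).
rewrite -!scalerDl rmorphB rmorph1; transitivity ((0 : C) *: P); last exact: scale0r.
congr (_ *: _); transitivity (z * conjc z - 1); first by ring.
by rewrite hz subrr.
Qed.

(** Hermitian elements are combinations of projections, and P = (1 - (1 - 2P)) / 2, where the
    reflection 1 - 2P is unitary. *)
Lemma commutant_span (S : 'M[C]_d -> Prop) :
  (forall a x y, S x -> S y -> S (a *: x + y)) -> S 0 ->
  (forall U, G U -> S U) -> forall x, A x -> S x.
Proof.
move=> Slin S0 SG; apply: commutant_hermitian_ind => // x hx xh.
have [P [a [hP Ph PP ->]]] := commutant_projections hx xh.
have SP k : S (P k).
  have g : G (1%:M + (-1 - 1) *: P k).
    by apply: projection_phase => //; rewrite ?PP ?eqxx // rmorphN rmorph1 mulrNN mulr1.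
  have := Slin (- 2^-1) _ _ (SG _ g) (Slin 2^-1 _ _ (SG _ ucommutant1) S0).
  rewrite addr0 scalerDr scalerA addrAC -scalerDl addNr scale0r add0r.
  by rewrite (_ : _ * _ = 1) ?scale1r //; field.
elim: (index_enum _) => [|k s ih]; first by rewrite big_nil.
by rewrite big_cons; exact: Slin.
Qed.

(** * Bilinear forms that vanish on all pairs ([U^h], [U]) *)

Section Bilinear.
Variable T : 'M[C]_d -> 'M[C]_d -> C.
Hypothesis Tl : forall a x y z, T (a *: x + y) z = a * T x z + T y z.
Hypothesis Tr : forall a x y z, T z (a *: x + y) = a * T z x + T z y.
Hypothesis TG : forall U, G U -> T U^h U = 0.

Lemma bilDl x y z : T (x + y) z = T x z + T y z.
Proof. by have := Tl 1 x y z; rewrite scale1r mul1r. Qed.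
Lemma bilDr x y z : T z (x + y) = T z x + T z y.
Proof. by have := Tr 1 x y z; rewrite scale1r mul1r. Qed.
Lemma bil0l z : T 0 z = 0.
Proof. by have := Tl (-1) 0 0 z; rewrite scaler0 addr0 mulN1r addNr. Qed.
Lemma bil0r z : T z 0 = 0.
Proof. by have := Tr (-1) 0 0 z; rewrite scaler0 addr0 mulN1r addNr. Qed.
Lemma bilZl a x z : T (a *: x) z = a * T x z.
Proof. by have := Tl a x 0 z; rewrite addr0 bil0l addr0. Qed.
Lemma bilZr a x z : T z (a *: x) = a * T z x.
Proof. by have := Tr a x 0 z; rewrite addr0 bil0r addr0. Qed.
Lemma bil_suml (I : finType) (F : I -> 'M[C]_d) z : T (\sum_i F i) z = \sum_i T (F i) z.
Proof. by apply: (big_morph (T^~ z)) => [x y|]; [exact: bilDl|exact: bil0l]. Qed.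
Lemma bil_sumr (I : finType) (F : I -> 'M[C]_d) z : T z (\sum_i F i) = \sum_i T z (F i).
Proof. by apply: (big_morph (T z)) => [x y|]; [exact: bilDr|exact: bil0r]. Qed.

Lemma bil_projection P : A P -> P^h = P -> P *m P = P -> T P P = T 1%:M P.
Proof.
move=> hP Ph PP.
have phase z : z * conjc z = 1 ->
    (z - 1) * T 1%:M P + (conjc z - 1) * T P 1%:M + (z - 1) * (conjc z - 1) * T P P = 0.
  move=> hz; have := TG (projection_phase hP Ph PP hz).
  rewrite mxadjD mxadj1 mxadjZ Ph bilDl !bilDr !bilZl !bilZr.
  have := TG ucommutant1; rewrite mxadj1 rmorphB rmorph1 => -> e.
  by rewrite -[RHS]e; ring.
(* [phase z] at z = -1 and z = i separates the three coefficients *)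
have e1 := phase (-1); have e2 := phase 'i%C.
have ci : conjc 'i%C = - 'i%C :> C by apply/eqP; rewrite eq_complex /= oppr0 !eqxx.
have ii : 'i%C * 'i%C = -1 :> C by rewrite -expr2 sqr_i.
move: e1 e2; rewrite rmorphN rmorph1 mulrNN mulr1 ci mulrN ii opprK.
move=> /(_ erefl) e1 /(_ erefl) e2.
set a := T 1%:M P in e1 e2 *; set b := T P 1%:M in e1 e2 *; set c := T P P in e1 e2 *.
have two : (2 : C) != 0 by rewrite pnatr_eq0.
have e3 : 2 * c = a + b.
  have : 2 * (2 * c - (a + b)) = 0 by rewrite -[RHS]e1; ring.
  by move/eqP; rewrite mulf_eq0 (negPf two) /= subr_eq0 => /eqP.
have e4 : 'i%C * (a - b) = 0.
  have e5 : ('i%C - 1) * (- 'i%C - 1) = 2 :> C.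
    by transitivity (1 - 'i%C * 'i%C : C); [ring|rewrite ii opprK].
  by rewrite e5 in e2; rewrite -[RHS]e2 e3; ring.
have i0 : ('i%C : C) != 0 by rewrite eq_complex /= oner_eq0 andbF.
move: e4 => /eqP; rewrite mulf_eq0 (negPf i0) /= subr_eq0 => /eqP ab.
by apply: (mulfI two); rewrite e3 -ab; ring.
Qed.

(** Expand x in its spectral projections. A sum of two orthogonal projections is again a projection,
    so the mixed terms cancel in pairs and only the diagonal ones survive. *)
Lemma bil_square x : A x -> x^h = x -> T x x = T 1%:M (x *m x).
Proof.
move=> hx xh; have [P [a [hP Ph PP e]]] := commutant_projections hx xh.
have two : (2 : C) != 0 by rewrite pnatr_eq0.
have PPk k : P k *m P k = P k by rewrite PP eqxx.
have off k l : k != l -> T (P k) (P l) + T (P l) (P k) = 0.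
  move=> kl; have := @bil_projection (P k + P l).
  rewrite bilDl !bilDr (bil_projection (hP k) (Ph k) (PPk k)).
  rewrite (bil_projection (hP l) (Ph l) (PPk l)).
  move=> h; apply: (addrI (T 1%:M (P k) + T 1%:M (P l))); rewrite addr0 -[RHS]h.
  - ring.
  - exact: commutantD.
  - by rewrite mxadjD !Ph.
  - by rewrite mulmxDl !mulmxDr !PP !eqxx [l == k]eq_sym (negPf kl) addr0 add0r.
have xx : x *m x = \sum_k ((a k)%:C%C * (a k)%:C%C) *: P k.
  rewrite e mulmx_suml; apply: eq_bigr => k _.
  rewrite mulmx_sumr (bigD1 k) //= big1 ?addr0 => [|l lk].
    by rewrite -scalemxAl -scalemxAr scalerA PPk.
  by rewrite -scalemxAl -scalemxAr PP eq_sym (negPf lk) !scaler0.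
pose t k l := (a k)%:C%C * (a l)%:C%C * T (P k) (P l).
have Txx : T x x = \sum_k \sum_l t k l.
  rewrite {1}e bil_suml; apply: eq_bigr => k _.
  rewrite e bil_sumr; apply: eq_bigr => l _; rewrite bilZl bilZr /t; ring.
have sw : \sum_k \sum_l t k l = \sum_k \sum_l t l k by rewrite exchange_big.
apply: (mulfI two); rewrite [LHS](_ : _ = T x x + T x x); last by ring.
rewrite {2}Txx sw Txx -big_split xx bil_sumr mulr_sumr; apply: eq_bigr => k _ /=.
rewrite -big_split (bigD1 k) //= big1 ?addr0 => [|l lk].
  rewrite bilZr /t (bil_projection (hP k) (Ph k) (PPk k)); ring.
transitivity ((a k)%:C%C * (a l)%:C%C * (T (P k) (P l) + T (P l) (P k))); first by rewrite /t; ring.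
by rewrite off ?mulr0 // eq_sym.
Qed.

(** Polarisation of [bil_square], extended from hermitian elements by linearity in each variable. *)
Lemma bil_jordan x y : A x -> A y -> T x y + T y x = T 1%:M (x *m y + y *m x).
Proof.
move=> hx hy; move: x hx; apply: commutant_hermitian_ind => [a x x' e e'|x hx xh].
  rewrite Tl Tr mulmxDl mulmxDr -scalemxAl -scalemxAr.
  rewrite (_ : _ + _ = a *: (x *m y + y *m x) + (x' *m y + y *m x')); last first.
    by rewrite scalerDr addrACA.
  by rewrite Tr -e -e'; ring.
move: y hy; apply: commutant_hermitian_ind => [a y y' e e'|y hy yh].
  rewrite Tl Tr mulmxDl mulmxDr -scalemxAl -scalemxAr.
  rewrite (_ : _ + _ = a *: (x *m y + y *m x) + (x *m y' + y' *m x)); last first.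
    by rewrite scalerDr addrACA.
  by rewrite Tr -e -e'; ring.
have := @bil_square (x + y); rewrite mxadjD xh yh => /(_ (commutantD hx hy) erefl).
rewrite mulmxDl !mulmxDr !bilDr !bilDl (bil_square hx xh) (bil_square hy yh) => e.
apply: (addrI (T 1%:M (x *m x) + T 1%:M (y *m y))).
transitivity (T 1%:M (x *m x) + T y x + (T x y + T 1%:M (y *m y))); first by ring.
rewrite e; ring.
Qed.

End Bilinear.
End Commutant.

(** * Functionals that kill every Ad U: the Jordan derivation is inner *)

Section Span.
Variables (R : realType) (d : nat).
Local Notation C := R[i].
Implicit Types (X Y U V x y c : 'M[C]_d).

Variable W : 'M[C]_d -> Prop.
Hypothesis Wadj : forall X, W X -> W X^h.
Local Notation A := (commutant W).
Local Notation G := (ucommutant W).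

Variable f : ('M[C]_d -> 'M[C]_d) -> C.
Hypothesis flin : forall a F H, f (fun Z => a *: F Z + H Z) = a * f F + f H.
Hypothesis fG : forall U, G U -> f (Ad U) = 0.

Let T x y := f (fun Z => x *m Z *m y).

Lemma functional_sum (I : finType) (a : I -> C) F :
  f (fun Z => \sum_i a i *: F i Z) = \sum_i a i * f (F i).
Proof.
have f0 : f (fun=> 0) = 0.
  have := flin (-1) (fun=> 0) (fun=> 0).
  by under eq_fun do rewrite scaler0 addr0; rewrite mulN1r addNr.
elim: (index_enum I) => [|i s ih].
  by rewrite big_nil; under eq_fun do rewrite big_nil.
by rewrite big_cons; under eq_fun do rewrite big_cons; rewrite flin ih.
Qed.

Let Tl a x y z : T (a *: x + y) z = a * T x z + T y z.
Proof.
rewrite -flin; congr f; apply/funext => Z.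
by rewrite mulmxDl mulmxDl -!scalemxAl.
Qed.

Let Tr a x y z : T z (a *: x + y) = a * T z x + T z y.
Proof.
rewrite -flin; congr f; apply/funext => Z.
by rewrite mulmxDr -!scalemxAr.
Qed.

Let TG U : G U -> T U^h U = 0. Proof. by move=> hU; exact: fG. Qed.

(* x |-> D x is a Jordan derivation of the commutant into its dual; averaging
   it over the unitary group shows that it is inner. *)
Let D x y := T x y - T 1%:M (y *m x).

(** This is the rule D(VUV) = D(V)UV + V D(U) V + VU D(V) in the dual bimodule, evaluated at c. It
    comes from the Jordan identity used twice, for T and for T twisted by V. *)
Lemma functional_triple V U c : G V -> G U -> A c ->
  D (V *m U *m V) c =
  D V (U *m V *m c) + D U (V *m c *m V) + D V (c *m V *m U).
Proof.
move=> hV hU hc; have [uV aV] := hV; have [uU aU] := hU.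
(* [T'] vanishes on unitaries as well, so the Jordan identity applies to it *)
pose T' x y := T (V *m x) (y *m V^h).
have Tl' a x y z : T' (a *: x + y) z = a * T' x z + T' y z.
  by rewrite /T' mulmxDr -scalemxAr Tl.
have Tr' a x y z : T' z (a *: x + y) = a * T' z x + T' z y.
  by rewrite /T' mulmxDl -scalemxAl Tr.
have TG' S : G S -> T' S^h S = 0.
  move=> hS; have := TG (ucommutantM hS (ucommutant_adj Wadj hV)).
  by rewrite mxadjM mxadjK.
have := bil_jordan Wadj Tl' Tr' TG' (commutantM aU aV) (commutantM hc aV).
have := bil_jordan Wadj Tl Tr TG (commutantM (commutantM aV hc) aV) aU.
have VV Z : Z *m V *m V^h = Z by rewrite -mulmxA (unitary_mxE uV) mulmx1.
rewrite /T' mulmx1 mulmxDl !mulmxA !VV.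
rewrite /D !mulmxA !(bilDr Tr) => e1 e2.
have -> : T (V *m U *m V) c = T V (U *m V *m c) + T V (c *m V *m U) - T (V *m c *m V) U.
  by rewrite -e2; ring.
have -> : T (V *m c *m V) U = T 1%:M (V *m c *m V *m U) + T 1%:M (U *m V *m c *m V) -
    T U (V *m c *m V).
  by rewrite -e1; ring.
ring.
Qed.

Variable E : 'M[C]_d -> 'M[C]_d.
Hypothesis mE : mixed G E.
Hypothesis Eleft : forall U X, G U -> Ad U (E X) = E X.
Hypothesis Eright : forall U X, G U -> E (Ad U X) = E X.
Hypothesis Esym : forall X Y, hs (E X) Y = hs X (E Y).

(** A closed form of the mean over the group of U -> [D U (c *m U^h)]; this functional implements
    D. *)
Let m c := f (fun Z => E (Z *m c)) - f (fun Z => Z *m c).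

Let mlin a b c : m (a *: b + c) = a * m b + m c.
Proof.
rewrite /m; have -> : (fun Z => E (Z *m (a *: b + c))) =
    fun Z => a *: E (Z *m b) + E (Z *m c).
  apply/funext => Z; rewrite mulmxDr -scalemxAr.
  exact: (mixed_linear mE).
have -> : (fun Z : 'M[C]_d => Z *m (a *: b + c)) = fun Z => a *: (Z *m b) + Z *m c.
  by apply/funext => Z; rewrite mulmxDr -scalemxAr.
by rewrite !flin; ring.
Qed.

(** Substituting V U V for U leaves the mean [m] unchanged because E is invariant on both sides. The
    triple rule then expresses [D V] through [m] for unitary V, and unitaries span the commutant. *)
Lemma functional_inner x y : A x -> A y -> D x y = m (y *m x) - m (x *m y).
Proof.
move=> hx hy.
have [l [lam [U [h0 h1 hG e]]]] := mE.
have lam1 : \sum_j (lam j)%:C%C = 1 :> C by rewrite -rmorph_sum h1.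
have e' X : E X = \sum_j (lam j)%:C%C *: Ad (U j)^h X.
  apply: hs_nondeg => Z; rewrite -Esym e hs_suml hs_sumr; apply: eq_bigr => j _.
  by rewrite hsZl hsZr conjc_real Ad_hs.
have EE X : E (E X) = E X.
  rewrite {1}e; under eq_bigr do rewrite Eleft //.
  by rewrite -scaler_suml lam1 scale1r.
have AE c : A c -> A (E c).
  move=> hc; rewrite e; apply: commutant_sum => j; apply: commutantZ.
  have [_ hj] := hG j; apply: commutantM => //; apply: commutantM => //.
  exact: commutant_adj.
have mdef V c : unitary_mx V -> D V (c *m V^h) = T V (c *m V^h) - T 1%:M c.
  by move=> hV; rewrite /D -mulmxA hV mulmx1.
have uU j : unitary_mx (U j) by case: (hG j).
have T1 c : T 1%:M c = f (fun Z => Z *m c).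
  by congr f; apply/funext => Z; rewrite mul1mx.
have mE1 c : \sum_j (lam j)%:C%C * D (U j) (c *m (U j)^h) = m c.
  under eq_bigr do rewrite (mdef _ _ (uU _)).
  under eq_bigr do rewrite mulrBr; rewrite sumrB -mulr_suml lam1 mul1r T1.
  congr (_ - _); rewrite -functional_sum; congr f; apply/funext => Z.
  by rewrite e'; apply: eq_bigr => j _; rewrite /Ad mxadjK !mulmxA.
(* The three terms are those of the triple rule at V U V, each averaged over U. Compared with an
   ordinary derivation there is an extra term containing [E c]. *)
have avg V c : G V -> A c ->
    m c = D V (E c *m V^h) + m (V *m c *m V^h) + D V (c *m V^h).
  move=> hV hc; have [uV aV] := hV; have uV' := unitary_mxE uV.
  have hV' := ucommutant_adj Wadj hV.
  transitivity (\sum_j (lam j)%:C%C *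
      D (V *m U j *m V) (c *m (V *m U j *m V)^h)).
    have uVUV j : unitary_mx (V *m U j *m V) by do 2 apply: unitary_mul => //.
    under [RHS]eq_bigr do rewrite (mdef _ _ (uVUV _)).
    under [RHS]eq_bigr do rewrite mulrBr; rewrite sumrB -mulr_suml lam1 mul1r T1.
    congr (_ - _); rewrite -functional_sum; congr f; apply/funext => Z.
    rewrite -(Eleft _ hV') -(Eright _ hV') e' Ad_sum; apply: eq_bigr => j _.
    by rewrite /Ad !mxadjM !mxadjK !mulmxA.
  have triple j : D (V *m U j *m V) (c *m (V *m U j *m V)^h) =
      D V (Ad (U j)^h (V *m c *m V^h) *m V^h) + D (U j) (V *m c *m V^h *m (U j)^h) +
      D V (c *m V^h).
    have [uj aj] := hG j; have uj' := unitary_mxE uj.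
    rewrite functional_triple //; last first.
      apply: commutantM => //; apply: commutant_adj => //.
      by apply: commutantM => //; exact: commutantM.
    rewrite /Ad !mxadjM mxadjK !mulmxA.
    rewrite -(mulmxA _ V^h V) uV mulmx1 -(mulmxA _ V^h V) uV mulmx1.
    by rewrite -(mulmxA _ (U j)^h (U j)) uj mulmx1.
  have triple' j : (lam j)%:C%C * D (V *m U j *m V) (c *m (V *m U j *m V)^h) =
      (lam j)%:C%C * D V (Ad (U j)^h (V *m c *m V^h) *m V^h) +
      (lam j)%:C%C * D (U j) (V *m c *m V^h *m (U j)^h) + (lam j)%:C%C * D V (c *m V^h).
    by rewrite triple mulrDr; congr (_ + _); exact: mulrDr.
  rewrite (eq_bigr _ (fun j _ => triple' j)) 2!big_split.
  rewrite mE1 -mulr_suml lam1 mul1r; congr (_ + _ + _).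
  have DZ z : D V (z *m V^h) = T V (z *m V^h) - T 1%:M z by exact: mdef.
  under eq_bigr do rewrite DZ mulrBr.
  rewrite DZ sumrB; congr (_ - _).
    have -> : E c = E (V *m c *m V^h) by rewrite -(Eright _ hV') /Ad mxadjK.
    rewrite e' mulmx_suml (bil_sumr Tr); apply: eq_bigr => j _.
    by rewrite -scalemxAl (bilZr Tr).
  have -> : E c = E (V *m c *m V^h) by rewrite -(Eright _ hV') /Ad mxadjK.
  by rewrite e' (bil_sumr Tr); apply: eq_bigr => j _; rewrite (bilZr Tr).
(* At [E c], which conjugation by V and E itself both fix, the identity [avg] reads m = D + m + D,
   so the extra term vanishes. *)
have DVE V c : G V -> A c -> D V (E c *m V^h) = 0.
  move=> hV hc; have := avg V (E c) hV (AE _ hc).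
  have -> : V *m E c *m V^h = E c.
    by rewrite -[RHS](Eleft _ (ucommutant_adj Wadj hV)) /Ad mxadjK.
  rewrite EE => h; have two : (2 : C) != 0 by rewrite pnatr_eq0.
  apply/eqP; rewrite -(mulrI_eq0 _ (mulfI two)); apply/eqP.
  by apply: (addrI (m (E c))); rewrite addr0 {2}h; ring.
have inner V z : G V -> A z -> D V z = m (z *m V) - m (V *m z).
  move=> hV hz; have [uV aV] := hV.
  have := avg V (z *m V) hV (commutantM hz aV).
  rewrite DVE //; last exact: commutantM.
  have VV Z : Z *m V *m V^h = Z by rewrite -mulmxA (unitary_mxE uV) mulmx1.
  by rewrite !mulmxA !VV => ->; ring.
move: x hx; apply: (commutant_span Wadj) => [a x x' ex ex'||V hV].
- rewrite mulmxDr mulmxDl -scalemxAr -scalemxAl !mlin.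
  transitivity (a * D x y + D x' y); last by rewrite ex ex'; ring.
  by rewrite /D Tl mulmxDr -scalemxAr Tr; ring.
- by rewrite /D mulmx0 mul0mx (bil0l Tl) (bil0r Tr) !subrr.
- exact: inner.
Qed.

(* By duality: a unital trace preserving map with Kraus operators in the
   commutant lies in the linear span of the Ad U, U unitary in the commutant. *)
Theorem functional_kraus (I : finType) (K : I -> 'M[C]_d) :
  (forall i, A (K i)) -> \sum_k (K k)^h *m K k = 1%:M ->
  \sum_k K k *m (K k)^h = 1%:M -> f (kraus K) = 0.
Proof.
move=> hK hu ht.
have m0 : m 0 = 0 by have := mlin (-1) 0 0; rewrite scaler0 addr0 mulN1r addNr.
have msum (F : I -> 'M[C]_d) : m (\sum_k F k) = \sum_k m (F k).
  apply: (big_morph m _ m0) => b c; rewrite -[b]scale1r mlin mul1r scale1r //.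
have -> : f (kraus K) = \sum_k T (K k)^h (K k).
  rewrite (_ : kraus K = fun Z => \sum_k 1 *: ((K k)^h *m Z *m K k)).
    by rewrite functional_sum; apply: eq_bigr => k _; rewrite mul1r.
  by apply/funext => Z; apply: eq_bigr => k _; rewrite scale1r.
(* The inner part sums to m(1) - m(1) by trace preservation and unitality, and the remaining term
   sums to T(1, 1) = f(Ad 1) = 0. *)
transitivity (\sum_k (m (K k *m (K k)^h) - m ((K k)^h *m K k) + T 1%:M (K k *m (K k)^h))).
  apply: eq_bigr => k _; rewrite -functional_inner //; last exact: commutant_adj.
  by rewrite /D; ring.
rewrite big_split sumrB /= -!msum -(bil_sumr Tr) hu ht subrr add0r.
by have := TG (ucommutant1 W); rewrite mxadj1.
Qed.

End Span.

(** * The mean is interior relative to the span of the conjugations *)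

Section Interior.
Variables (R : realType) (d : nat).
Local Notation C := R[i].
Implicit Types (X Y U V x y c : 'M[C]_d).

Definition super_index : finType := (('I_d * 'I_d) * ('I_d * 'I_d))%type.

(** Vectorisation on matrix units: spans of maps become row spaces, and functionals become column
    vectors. *)
Definition super_row (F : 'M[C]_d -> 'M[C]_d) : 'rV[C]_#|super_index| :=
  \row_p F (delta_mx (enum_val p : super_index).1.1 (enum_val p : super_index).1.2)
    (enum_val p : super_index).2.1 (enum_val p : super_index).2.2.

Lemma super_row_linear a F H :
  super_row (fun Z => a *: F Z + H Z) = a *: super_row F + super_row H.
Proof. by apply/rowP => p; rewrite !mxE. Qed.

Lemma super_row_sum (I : finType) (a : I -> C) F :
  super_row (fun Z => \sum_i a i *: F i Z) = \sum_i a i *: super_row (F i).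
Proof.
apply/rowP => p; rewrite mxE /= !summxE; apply: eq_bigr => i _.
by rewrite !mxE.
Qed.

Lemma super_row_inj F H : is_linear_map F -> is_linear_map H ->
  super_row F = super_row H -> F =1 H.
Proof.
move=> hF hH e; apply: linear_map_ext => // i j; apply/matrixP => a b.
have h (p : super_index) : F (delta_mx p.1.1 p.1.2) p.2.1 p.2.2 =
    H (delta_mx p.1.1 p.1.2) p.2.1 p.2.2.
  have := congr1 (fun r : 'rV[C]_#|super_index| => r 0 (enum_rank p)) e.
  by rewrite !mxE !enum_rankK.
exact: (h ((i, j), (a, b))).
Qed.

(** A finite family of maximal rank: adjoining a conjugation outside its row space would raise the
    rank. *)
Lemma finite_spanning_family (G : 'M[C]_d -> Prop) :
  exists (k : nat) (U : 'I_k -> 'M[C]_d), (forall j, G (U j)) /\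
    forall V, G V -> (super_row (Ad V) <= \matrix_j super_row (Ad (U j)))%MS.
Proof.
pose B k (U : 'I_k -> 'M[C]_d) := \matrix_j super_row (Ad (U j)).
pose P (r : nat) := `[< exists k (U : 'I_k -> 'M[C]_d), (forall j, G (U j)) /\ \rank (B k U) = r >].
have exP : exists r, P r.
  exists (\rank (B 0%N (fun=> 0))); apply/asboolP; exists 0%N, (fun=> 0); split=> //.
  by case.
have ubP r : P r -> (r <= #|super_index|)%N.
  by move=> /asboolP [k [U [_ <-]]]; exact: rank_leq_col.
have [r /asboolP [k [U [hG hr]]] rmax] := ex_maxnP exP ubP.
exists k, U; split=> // V hV; apply: contrapT => /negP nle.
pose U' (i : 'I_(k + 1)) := match fintype.split i with inl j => U j | inr _ => V end.
have eB : B _ U' = col_mx (B k U) (super_row (Ad V)).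
  apply/matrixP => i q; rewrite !mxE /U'.
  by case: fintype.splitP => j _; rewrite !mxE.
have : (r < \rank (B _ U'))%N.
  rewrite eB -hr; apply: rank_ltmx; rewrite /ltmx.
  by rewrite col_mx_sub submx_refl /= nle andbT -addsmxE addsmxSl.
rewrite ltnNge rmax //; apply/asboolP; exists (k + 1)%N, U'; split=> // i.
by rewrite /U'; case: fintype.split.
Qed.

Variable W : 'M[C]_d -> Prop.
Hypothesis Wadj : forall X, W X -> W X^h.
Local Notation A := (commutant W).
Local Notation G := (ucommutant W).

Variable E : 'M[C]_d -> 'M[C]_d.
Hypothesis mE : mixed G E.
Hypothesis Eleft : forall U X, G U -> Ad U (E X) = E X.
Hypothesis Eright : forall U X, G U -> E (Ad U X) = E X.
Hypothesis Esym : forall X Y, hs (E X) Y = hs X (E Y).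

(** Membership in a row space is tested against the columns of [cokermx B]; each column is a
    functional that kills all conjugations by G, hence also [kraus K]. *)
Lemma kraus_in_span k (U : 'I_k -> 'M[C]_d) (I : finType) (K : I -> 'M[C]_d) :
  (forall V, G V -> (super_row (Ad V) <= \matrix_j super_row (Ad (U j)))%MS) ->
  (forall i, A (K i)) -> \sum_k (K k)^h *m K k = 1%:M ->
  \sum_k K k *m (K k)^h = 1%:M ->
  (super_row (kraus K) <= \matrix_j super_row (Ad (U j)))%MS.
Proof.
set B := \matrix_j _ => hB hK hu ht; rewrite submxE; apply/eqP/rowP => q; rewrite [RHS]mxE.
pose f F := (super_row F *m cokermx B) 0 q.
apply: (@functional_kraus _ _ _ Wadj f _ _ _ mE Eleft Eright Esym _ K hK hu ht).
- by move=> a F H; rewrite /f super_row_linear mulmxDl -scalemxAl !mxE.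
- by move=> V /hB; rewrite submxE /f => /eqP ->; rewrite mxE.
Qed.

Theorem mean_interior : exists2 eps : R, 0 < eps &
  forall (I : finType) (K : I -> 'M[C]_d), (forall i, A (K i)) ->
    \sum_k (K k)^h *m K k = 1%:M -> \sum_k K k *m (K k)^h = 1%:M ->
    (forall i j, sqnorm (kraus K (delta_mx i j) - E (delta_mx i j)) <= eps ^+ 2) ->
    mixed G (kraus K).
Proof.
have [k [U [hU hB]]] := finite_spanning_family G.
set B := \matrix_j _ in hB.
have [l [lam [V [h0 h1 hV e]]]] := mE.
have [i1 li1] : exists i, 0 < lam i.
  apply: contrapT => /forallNP neg.
  have : \sum_i lam i <= 0 by apply: sumr_le0 => i _; rewrite leNgt; apply/negP/neg.
  by rewrite h1 ler10.
pose Q := pinvmx B.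
pose M : R := \sum_j \sum_p (`|complex.Re (Q p j)| + `|complex.Im (Q p j)|).
have M0 : 0 <= M by do 2 (apply: sumr_ge0 => ? _); rewrite addr_ge0.
(* [M] dominates the entries of the pseudo-inverse, so entries of size [eps] in the difference
   produce coefficients of size at most [lam i1 / k.+1], the weight available for each [U j]. The
   summand 1 keeps the divisor positive. *)
pose eps := lam i1 / k.+1%:R / (M + 1).
have M1 : 0 < M + 1 by rewrite ltr_wpDl.
have eps0 : 0 < eps by rewrite /eps !divr_gt0 // ltr0Sn.
exists eps => // I K hK hu ht close.
(* For d > 0 the total weight is read off a diagonal entry of the identity at the end; for d = 0
   there is no entry and any decomposition will do. *)
have [d0|d0] := posnP d.
  move: K hK hu ht close; rewrite /mixed => K hK hu ht close.
  exists 1%N, (fun=> 1), (fun=> 1%:M); split=> //.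
  - by rewrite big_ord1.
  - by move=> _; exact: ucommutant1.
  - by move=> X; apply/matrixP => i; have := ltn_ord i; rewrite {2}d0.
pose dl := super_row (kraus K) - super_row E.
have dlB : (dl <= B)%MS.
  apply: addmx_sub; first exact: kraus_in_span.
  rewrite eqmx_opp (_ : E = fun X => \sum_j (lam j)%:C%C *: Ad (V j) X); last exact/funext.
  by rewrite super_row_sum; apply: summx_sub => j _; apply: scalemx_sub; exact: hB.
pose c := dl *m Q.
have cB : c *m B = dl by exact: mulmxKpV.
have linE := mixed_linear mE.
have diff : (fun X => kraus K X - E X) =1 fun X => \sum_j c 0 j *: Ad (U j) X.
  apply: super_row_inj.
  - move=> a X Y; rewrite linE (kraus_linear K); rewrite scalerBr opprD addrACA //.
  - by apply: sum_linear => j; exact: Ad_linear.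
  - rewrite super_row_sum -[LHS]/(super_row (fun X => kraus K X - E X)).
    transitivity dl; first by apply/rowP => p; rewrite !mxE.
    by rewrite -cB mulmx_sum_row; apply: eq_bigr => j _; rewrite rowK.
have Eadj X : E X^h = (E X)^h.
  rewrite !e mxadj_sum; apply: eq_bigr => j _.
  by rewrite mxadjZ conjc_real Ad_adj.
(* [kraus K] and E both commute with the adjoint, so the coefficients may be averaged with their
   conjugates and become real. *)
have diffR X : kraus K X = E X + \sum_j (complex.Re (c 0 j))%:C%C *: Ad (U j) X.
  have e1 : kraus K X - E X = \sum_j c 0 j *: Ad (U j) X by exact: diff.
  have e2 : kraus K X - E X = \sum_j conjc (c 0 j) *: Ad (U j) X.
    rewrite -[LHS]mxadjK mxadjB -kraus_adj -Eadj [X in X^h = _]diff mxadj_sum.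
    by apply: eq_bigr => j _; rewrite mxadjZ Ad_adj mxadjK.
  apply/eqP; rewrite addrC -subr_eq; apply/eqP.
  have two : (2 : C) != 0 by rewrite pnatr_eq0.
  apply: (scalerI two); rewrite scaler_nat mulr2n {1}e1 e2 -big_split scaler_sumr.
  by apply: eq_bigr => j _ /=; rewrite -scalerDl addcJ scalerA.
have cbound j : `|complex.Re (c 0 j)| <= lam i1 / k.+1%:R.
  have -> : lam i1 / k.+1%:R = eps * (M + 1) by rewrite /eps divfK ?gt_eqF.
  apply: le_trans (_ : eps * M <= _); last by rewrite ler_wpM2l ?ltW // ltrDl.
  rewrite mxE raddf_sum; apply: le_trans (ler_norm_sum _ _ _) _.
  rewrite /M (bigD1 j) //= mulrDr; apply: ler_wpDr.
    apply: mulr_ge0; first exact: ltW.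
    by do 2 (apply: sumr_ge0 => ? _); rewrite addr_ge0.
  rewrite mulr_sumr; apply: ler_sum => p _ /=.
  have : complex.Re (dl 0 p) ^+ 2 + complex.Im (dl 0 p) ^+ 2 <= eps ^+ 2.
    pose q : super_index := enum_val p.
    have -> : dl 0 p = (kraus K (delta_mx q.1.1 q.1.2) - E (delta_mx q.1.1 q.1.2)) q.2.1 q.2.2.
      by rewrite !mxE.
    exact: le_trans (sqnorm_entry _ _ _) (close _ _).
  rewrite ReM; move: (dl 0 p) (Q p j) => [a b] [a' b'] /= hab.
  have ha : `|a| <= eps by rewrite ler_norml; apply/andP; split; nra.
  have hb : `|b| <= eps by rewrite ler_norml; apply/andP; split; nra.
  apply: le_trans (ler_normB _ _) _; rewrite !normrM mulrDr.
  by apply: lerD; exact: ler_wpM2r.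
pose w (p : 'I_l + ('I_k * 'I_l)) : R := match p with
  | inl i => lam i / k.+1%:R
  | inr (j, i) => lam i / k.+1%:R + (i == i1)%:R * complex.Re (c 0 j) end.
(* E = Ad (N j) \o E exhibits Ad (U j) with the positive weight lam i1 in E;
   averaging these expressions of E leaves room to absorb the coefficients c *)
pose N j := (V i1)^h *m U j.
have GN j : G (N j) by apply: ucommutantM => //; exact: ucommutant_adj.
pose Z (p : 'I_l + ('I_k * 'I_l)) := match p with
  | inl i => V i | inr (j, i) => V i *m N j end.
have k0 : k.+1%:R != 0 :> R by rewrite pnatr_eq0.
have wZ X : kraus K X = \sum_p (w p)%:C%C *: Ad (Z p) X.
  transitivity (\sum_i (lam i / k.+1%:R)%:C%C *: Ad (V i) X +
      \sum_j \sum_i (w (inr (j, i)))%:C%C *: Ad (V i *m N j) X); last first.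
    by rewrite big_sumType pair_bigA; congr (_ + _); apply: eq_bigr => -[j i] _.
  rewrite diffR.
  have inner j : \sum_i (w (inr (j, i)))%:C%C *: Ad (V i *m N j) X =
      (k.+1%:R^-1)%:C%C *: E X + (complex.Re (c 0 j))%:C%C *: Ad (U j) X.
    rewrite /w; under eq_bigr do rewrite rmorphD scalerDl.
    rewrite big_split; congr (_ + _).
      rewrite -(Eleft X (GN j)) e Ad_sum scaler_sumr; apply: eq_bigr => i _.
      by rewrite AdM scalerA -rmorphM mulrC.
    rewrite (bigD1 i1) //= eqxx mul1r big1 ?addr0 => [|i ii1].
      by rewrite /N mulmxA (unitary_mxE (proj1 (hV i1))) mul1mx.
    by rewrite (negPf ii1) mul0r scale0r.
  rewrite (eq_bigr _ (fun j _ => inner j)).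
  rewrite big_split /= addrA; congr (_ + _).
  have -> : \sum_i (lam i / k.+1%:R)%:C%C *: Ad (V i) X = (k.+1%:R^-1)%:C%C *: E X.
    rewrite e scaler_sumr; apply: eq_bigr => i _.
    by rewrite scalerA -rmorphM mulrC.
  rewrite sumr_const card_ord -mulrS -scaler_nat scalerA.
  by rewrite -(rmorph_nat (real_complex R)) -rmorphM /= mulfV // scale1r.
apply: (@mixed_fin _ _ _ _ _ w Z) => [p||p|//].
- case: p => [i|[j i]] /=; first by rewrite divr_ge0.
  have [->|_] := eqVneq i i1; last by rewrite mul0r addr0 divr_ge0.
  by rewrite mul1r -lerBlDl sub0r; have := cbound j; rewrite ler_norml => /andP[].
(* The weights sum to 1 because [kraus K] and all the conjugations are unital: it suffices to
   compare both sides at the identity. *)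
- have := wZ 1%:M; have -> : kraus K 1%:M = 1%:M.
    by rewrite -[RHS]hu; apply: eq_bigr => j _; rewrite mulmx1.
  have GZ p : G (Z p) by case: p => [i|[j i]] //=; exact: ucommutantM.
  have -> : \sum_p (w p)%:C%C *: Ad (Z p) 1%:M = (\sum_p w p)%:C%C *: (1%:M : 'M[C]_d).
    rewrite rmorph_sum scaler_suml; apply: eq_bigr => p _.
    by rewrite /Ad mulmx1 (proj1 (GZ p)).
  move=> /(congr1 (fun m : 'M[C]_d => m (Ordinal d0) (Ordinal d0))).
  by rewrite !mxE eqxx mulr1 => /complexI <-.
- by case: p => [i|[j i]] //=; exact: ucommutantM.
Qed.

End Interior.

(** * Subspaces given by predicates, and unitary parts of intertwiners *)

Section Aux.
Variables (R : realType) (d : nat).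
Local Notation C := R[i].
Implicit Types (X Y U x y : 'M[C]_d).

Lemma channel_kraus (Phi : 'M[C]_d -> 'M[C]_d) : unital_channel Phi ->
  exists (p : nat) (K : 'I_p -> 'M[C]_d), [/\ Phi =1 kraus K,
    \sum_k (K k)^h *m K k = 1%:M & \sum_k K k *m (K k)^h = 1%:M].
Proof.
move=> [lin cp un tp]; have [p [K e]] := kraus_decomposition lin cp.
exists p, K; split=> //.
  by apply: kraus_unital; rewrite /unital -e.
by apply: kraus_trace => X; rewrite -e.
Qed.

(** Dimension counting needs a [vspace]; a subspace of maximal dimension contained in P already
    exhausts P. *)
Lemma subspace_vspace (P : 'M[C]_d -> Prop) : P 0 ->
  (forall a x y, P x -> P y -> P (a *: x + y)) ->
  exists S : {vspace 'M[C]_d}, forall x, x \in S <-> P x.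
Proof.
move=> P0 Plin.
pose Q (r : nat) := `[< exists S : {vspace 'M[C]_d}, (forall x, x \in S -> P x) /\ \dim S = r >].
have exQ : exists r, Q r.
  exists 0%N; apply/asboolP; exists 0%VS; rewrite dimv0; split=> // x.
  by rewrite memv0 => /eqP ->.
have ubQ r : Q r -> (r <= \dim {:'M[C]_d})%N.
  by move=> /asboolP [S [_ <-]]; exact/dimvS/subvf.
have [r /asboolP [S [hS hr]] rmax] := ex_maxnP exQ ubQ.
exists S => x; split; first exact: hS.
move=> Px; have hS' : forall y, y \in (S + <[x]>)%VS -> P y.
  move=> y /memv_addP [u uS [v /vlineP [a ->] ->]].
  by rewrite addrC; apply: Plin => //; exact: hS.
have : (\dim (S + <[x]>) <= \dim S)%N.
  by rewrite hr; apply: rmax; apply/asboolP; exists (S + <[x]>)%VS.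
move=> le; have e : S = (S + <[x]>)%VS by apply/eqP; rewrite eqEdim addvSl le.
by rewrite e; apply: (subvP (addvSr _ _)); exact: memv_line.
Qed.

Lemma injective_subspace_onto (P : 'M[C]_d -> Prop) (f : 'M[C]_d -> 'M[C]_d) : P 0 ->
  (forall a x y, P x -> P y -> P (a *: x + y)) ->
  is_linear_map f -> (forall x, P x -> P (f x)) -> (forall x, P x -> f x = 0 -> x = 0) ->
  forall y, P y -> exists2 x, P x & f x = y.
Proof.
move=> P0 Plin flin fP finj y Py.
have [S hS] := subspace_vspace P0 Plin.
have flin' : linear f by exact: flin.
pose f' : {linear 'M[C]_d -> 'M[C]_d} :=
  HB.pack f (GRing.isLinear.Build C 'M[C]_d 'M[C]_d *:%R f flin').
have fE x : linfun f' x = f x by rewrite lfunE.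
have ker0 : (S :&: lker (linfun f') = 0)%VS.
  apply/eqP; rewrite -subv0; apply/subvP => x /memv_capP [xS].
  by rewrite memv_ker fE memv0 => /eqP h; apply/eqP/finj => //; exact/hS.
have sub : (linfun f' @: S <= S)%VS.
  apply/subvP => z /memv_imgP [x xS ->]; rewrite fE; exact/hS/fP/hS.
have : (linfun f' @: S)%VS = S.
  by apply/eqP; rewrite eqEdim sub limg_dim_eq /=.
move=> e; have : y \in (linfun f' @: S)%VS by rewrite e; exact/hS.
by move=> /memv_imgP [x xS ->]; exists x; [exact/hS|rewrite fE].
Qed.

(** The intertwining relation and its adjoint show that [K^h *m K] commutes with every f X, hence so
    does its inverse square root S; thus [K *m S] intertwines as K does and is unitary. *)
Lemma polar_intertwiner (V : 'M[C]_d -> Prop) (f : 'M[C]_d -> 'M[C]_d) (K : 'M[C]_d) :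
  (forall X, V X -> V X^h) -> (forall X, f X^h = (f X)^h) -> K \in unitmx ->
  (forall X, V X -> X *m K = K *m f X) ->
  exists U, unitary_mx U /\ forall X, V X -> f X = Ad U X.
Proof.
move=> Vadj fadj uK hK.
have hP : (K^h *m K)^h = K^h *m K by rewrite mxadjM mxadjK.
have [Q [a [hQ e]]] := hermitian_spectral hP.
(* An eigenvalue of [K^h *m K] is |K x|^2 at a unit eigenvector x, which is nonzero since K is
   invertible. *)
have a0 k : 0 < a k.
  pose x := Q^h *m delta_mx k (0 : 'I_1).
  have ax : (a k)%:C%C = (sqnorm (K *m x))%:C%C.
    transitivity ((x^h *m (K^h *m K) *m x) 0 0); first by rewrite e spectral_fun_form.
    by rewrite sqnormE /hs mxadjM /mxtrace big_ord1 !mulmxA.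
  rewrite (complexI ax) lt_neqAle sqnorm_ge0 andbT eq_sym; apply/eqP => /sqnorm_eq0 Kx.
  have x0 : x = 0 by rewrite -[x](mulKmx uK) Kx mulmx0.
  have := spectral_fun_form (fun=> 1) k hQ; rewrite -/x /= spectral_fun1 // mulmx1 x0 mulmx0 mxE.
  by move/eqP; rewrite eq_sym oner_eq0.
pose S := spectral_fun Q (fun k => ((Num.sqrt (a k))^-1)%:C%C).
have Sh : S^h = S by rewrite spectral_fun_adj; apply: eq_spectral_fun => k; rewrite conjc_real.
have uU : unitary_mx (K *m S).
  rewrite /unitary_mx mxadjM Sh mulmxA -(mulmxA S) e !spectral_funM // -(spectral_fun1 hQ).
  apply: eq_spectral_fun => k; rewrite -!rmorphM /=.
  rewrite -[in X in _ * X * _](sqr_sqrtr (ltW (a0 k))).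
  have : Num.sqrt (a k) != 0 by rewrite gt_eqF // sqrtr_gt0.
  by move=> h; congr (_%:C%C); field.
exists (K *m S); split=> // X VX; set Y := f X.
have e1 : X *m K = K *m Y by exact: hK.
have e2 : K^h *m X = Y *m K^h.
  have := congr1 (@mxadj R d d) (hK _ (Vadj _ VX)).
  by rewrite !mxadjM mxadjK fadj mxadjK.
have comm : Y *m S = S *m Y.
  apply: (spectral_fun_comm hQ (g := fun k => (a k)%:C%C)); first by move=> i j /complexI ->.
  by rewrite -e mulmxA -e2 -!mulmxA e1.
rewrite /Ad -(mulmxA _ X) (mulmxA X K) e1 -(mulmxA K) comm (mulmxA K) mulmxA uU mul1mx //.
Qed.

End Aux.

(** * Isometric and transient parts of the semigroup *)

Section Semigroup.
Variables (R : realType) (d : nat) (Phi : R -> 'M[R[i]]_d -> 'M[R[i]]_d).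
Local Notation C := R[i].
Implicit Types (X Y Z U x y : 'M[C]_d).
Hypothesis Q : unital_QDS Phi.

Lemma QDS_kraus t : 0 <= t ->
  exists (p : nat) (K : 'I_p -> 'M[C]_d), [/\ Phi t =1 kraus K,
    \sum_k (K k)^h *m K k = 1%:M & \sum_k K k *m (K k)^h = 1%:M].
Proof. by case: Q => ch _ _ _ /ch /channel_kraus. Qed.

Lemma QDS_linear t : 0 <= t -> is_linear_map (Phi t).
Proof. by case: Q => ch _ _ _ /ch []. Qed.

Lemma QDS_adj t X : 0 <= t -> Phi t X^h = (Phi t X)^h.
Proof. by move=> /QDS_kraus [p [K [e _ _]]]; rewrite !e kraus_adj. Qed.

Lemma QDS0 X : Phi 0 X = X.
Proof. by case: Q => _ ->. Qed.

Lemma QDSD s t X : 0 <= s -> 0 <= t -> Phi (s + t) X = Phi s (Phi t X).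
Proof. by case: Q => _ _ e _ s0 t0; rewrite e. Qed.

Lemma QDS_contraction t X : 0 <= t -> sqnorm (Phi t X) <= sqnorm X.
Proof. by move=> /QDS_kraus [p [K [-> hu ht]]]; exact: kraus_contraction. Qed.

Lemma QDS_decreasing s t X : 0 <= s -> s <= t -> sqnorm (Phi t X) <= sqnorm (Phi s X).
Proof.
move=> s0 st; rewrite -(subrK s t) QDSD ?subr_ge0 //.
by apply: QDS_contraction; rewrite subr_ge0.
Qed.

Definition isometric X := forall t, 0 <= t -> sqnorm (Phi t X) = sqnorm X.

Lemma isometric_adj X : isometric X -> isometric X^h.
Proof. by move=> h t t0; rewrite QDS_adj // !sqnorm_adj h. Qed.

Lemma isometric0 : isometric 0.
Proof. by move=> t t0; rewrite linear_map0 //; exact: QDS_linear. Qed.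

(** Norm preservation is not visibly linear; the intertwining relations of [kraus_isometryP] are. *)
Lemma isometric_lin a X Y : isometric X -> isometric Y -> isometric (a *: X + Y).
Proof.
move=> hX hY t t0; have := hY t t0; have := hX t t0.
have [p [K [e hu ht]]] := QDS_kraus t0; rewrite !e.
move=> /(kraus_isometryP _ hu ht) eX /(kraus_isometryP _ hu ht) eY.
apply/kraus_isometryP => // k.
by rewrite mulmxDl -scalemxAl eX eY (kraus_linear K) mulmxDr -scalemxAr.
Qed.

Lemma isometric_Phi t X : 0 <= t -> isometric X -> isometric (Phi t X).
Proof. by move=> t0 hX s s0; rewrite -QDSD // !hX // addr_ge0. Qed.

Lemma isometric_onto t Y : 0 <= t -> isometric Y -> exists2 X, isometric X & Phi t X = Y.
Proof.
move=> t0; apply: injective_subspace_onto => [||||X hX e].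
- exact: isometric0.
- exact: isometric_lin.
- exact: QDS_linear.
- by move=> X; exact: isometric_Phi.
- by apply: sqnorm_eq0; rewrite -(hX t t0) e sqnorm_0.
Qed.

(* the orthogonal complement of the isometric subspace *)
Definition transient Y := forall Z, isometric Z -> hs Z Y = 0.

(** Every isometric Z is Phi_t X with X isometric, and X K_k = K_k Z gives <Phi_t X, Phi_t Y> = <X,
    Y> for arbitrary Y. *)
Lemma transient_Phi t Y : 0 <= t -> transient Y -> transient (Phi t Y).
Proof.
move=> t0 hY Z hZ; have [X hX <-] := isometric_onto t0 hZ.
have := hX t t0; have [p [K [e hu ht]]] := QDS_kraus t0; rewrite !e.
move=> /(kraus_isometryP _ hu ht) eX.
rewrite -(hY X hX) -hs_conj -[RHS]hs_conj; congr (conjc _).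
rewrite [RHS]/hs -(tr_kraus _ ht) {1}/hs -kraus_adj {1}/kraus mulmx_suml !raddf_sum.
by apply: eq_bigr => k _ /=; rewrite -!mulmxA -eX !mulmxA.
Qed.

Lemma mcvg_kraus (F : set_system nat) (FU : UltraFilter F) (I : finType) (K : I -> 'M[C]_d) u Y :
  mcvg F u Y -> mcvg F (fun n => kraus K (u n)) (kraus K Y).
Proof.
move=> uY; apply: mcvg_sum => k; apply: mcvgM; last exact: mcvg_cst.
by apply: mcvgM => //; exact: mcvg_cst.
Qed.

(** Let L be a limit point of the orbit. Norms decrease along the orbit, so |L| is a lower bound for
    them and L is isometric; it is also transient, hence orthogonal to itself and zero. No spectral
    estimate enters. *)
Lemma transient_decay Y (eps : R) : 0 < eps -> transient Y ->
  exists2 T, 0 <= T & forall t, T <= t -> sqnorm (Phi t Y) <= eps.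
Proof.
move=> eps0 hY; have [F [FU sF]] := nonprincipal_ultra.
have [L cL] : exists L, mcvg F (fun n => Phi n%:R Y) L.
  by apply: (@mcvg_bounded _ _ _ _ _ _ (sqnorm Y)) => n; exact: QDS_contraction.
have cu : (fun n => sqnorm (Phi n%:R Y)) @ F --> sqnorm L by exact: sqnorm_cvg cL.
have Lle t : 0 <= t -> sqnorm L <= sqnorm (Phi t Y).
  move=> t0; apply: (@closed_cvg _ _ F _ _ (fun x : R => x <= sqnorm (Phi t Y)) _ _ _ cu).
    exact: closed_le.
  by apply: filterS (ultra_natmul_ge t sF) => n tn; exact: QDS_decreasing.
have Liso : isometric L.
  move=> s s0; apply/le_anti; rewrite QDS_contraction //=.
  have [p [K [e _ _]]] := QDS_kraus s0.
  have cs : (fun n => sqnorm (kraus K (Phi n%:R Y))) @ F --> sqnorm (kraus K L).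
    by apply: sqnorm_cvg; exact: mcvg_kraus.
  rewrite e; apply: (ultra_cvg_ge _ cs) => n.
  by rewrite -e -QDSD //; apply: Lle; exact: addr_ge0.
have Ltr : transient L.
  move=> Z hZ; have h : ccvg F (fun n => hs Z (Phi n%:R Y)) (hs Z L).
    by apply: mcvg_tr; apply: mcvgM => //; exact: mcvg_cst.
  apply: ccvg_uniq h _; rewrite (_ : (fun _ => _) = fun=> 0); first exact: ccvg_cst.
  by apply/funext => n; apply: transient_Phi.
have L0 : sqnorm L = 0 by apply: complexI; rewrite sqnormE Ltr.
have near_eps : F [set n | sqnorm (Phi n%:R Y) < eps].
  by rewrite L0 in cu; apply: (cu [set x | x < eps]); exact: lt_nbhsl.
have [n hn] := filter_ex near_eps.
exists n%:R => // t nt; apply: le_trans (ltW hn); exact: QDS_decreasing.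
Qed.

Lemma QDS_cvg (F : set_system nat) (FU : UltraFilter F) (u : nat -> R) (t : R) X :
  (forall n, 0 <= u n) -> 0 <= t -> u @ F --> t ->
  mcvg F (fun n => Phi (u n) X) (Phi t X).
Proof.
move=> u0 t0 ut i j.
(* Continuity is given only within the half-line, which contains every [u n]. *)
have uw : u @ F --> within [set t : R | 0 <= t] (nbhs t).
  move=> B /ut FB; apply: (@filterS _ F _ _ (u @^-1` B) _ FB) => n /= h.
  by apply: h => /=; exact: u0.
have [_ _ _ /(_ X i j) [cR cI]] := Q.
split.
- have /subspace_continuousP /(_ t t0) h := cR.
  by apply: cvg_comp uw h.
- have /subspace_continuousP /(_ t t0) h := cI.
  by apply: cvg_comp uw h.
Qed.

(* Equal to \sum_k conj (tr K_k) K_k for any Kraus family K of Phi t, and to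
   d%:R%:M at t = 0. *)
Definition intertwiner t : 'M[C]_d := \matrix_(j, k) \sum_l Phi t (delta_mx l j) l k.

Lemma intertwinerP t X : 0 <= t -> isometric X ->
  X *m intertwiner t = intertwiner t *m Phi t X.
Proof.
move=> t0 hX; have := hX t t0; have [p [K [e hu ht]]] := QDS_kraus t0; rewrite !e.
move=> /(kraus_isometryP _ hu ht) eX.
have -> : intertwiner t = \sum_k conjc (\tr (K k)) *: K k.
  apply/matrixP => a b; rewrite mxE summxE.
  under eq_bigr do rewrite e summxE; rewrite exchange_big; apply: eq_bigr => k _.
  rewrite mxE rmorph_sum mulr_suml; apply: eq_bigr => l _ /=.
  rewrite mxE (bigD1 a) //= big1 ?addr0 => [|c ca].
    rewrite mxE (bigD1 l) //= big1 ?addr0 => [|c cl].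
      by rewrite !mxE !eqxx mulr1.
    by rewrite !mxE (negPf cl) mulr0.
  by rewrite mxE big1 ?mul0r // => x _; rewrite !mxE (negPf ca) andbF mulr0.
rewrite mulmx_sumr mulmx_suml; apply: eq_bigr => k _.
by rewrite -scalemxAr -scalemxAl eX.
Qed.

(** [intertwiner] is written in terms of Phi t, so its determinant is continuous in t, unlike a
    choice of Kraus operators. At t = 0 it equals d^d, which is nonzero even for d = 0. *)
Lemma intertwiner_unit : exists2 dl : R, 0 < dl &
  forall t, 0 <= t -> t < dl -> intertwiner t \in unitmx.
Proof.
apply: contrapT => neg.
have hn n : exists t : R, [/\ 0 <= t, t < harmonic n & intertwiner t \notin unitmx].
  apply: contrapT => /forallNP h; apply: neg; exists (harmonic n); first exact: harmonic_gt0.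
  by move=> t t0 tn; apply: contrapT => /negP nu; apply: (h t).
pose t n := projT1 (cid (hn n)).
have ht n : [/\ 0 <= t n, t n < harmonic n & intertwiner (t n) \notin unitmx].
  exact: (projT2 (cid (hn n))).
have [F [FU sF]] := nonprincipal_ultra.
have t0 : t @ F --> (0 : R).
  apply: eventually_ultra => //.
  apply: (@squeeze_cvgr _ _ _ _ (fun=> 0) (@harmonic R)); last 2 first.
  - exact: cvg_cst.
  - exact: cvg_harmonic.
  by apply: nearW => n; have [h1 /ltW h2 _] := ht n; rewrite h1.
have ci : mcvg F (fun n => intertwiner (t n)) (intertwiner 0).
  move=> j k; rewrite mxE; under eq_fun do rewrite mxE.
  apply: ccvg_sum => l; apply: QDS_cvg => // n; by case: (ht n).
have i0 : intertwiner 0 = d%:R%:M.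
  apply/matrixP => j k; rewrite !mxE.
  under eq_bigr do rewrite QDS0 mxE eqxx eq_sym /=.
  rewrite sumr_const card_ord eq_sym; case: eqP => _ //.
  by rewrite mul0rn.
have h : ccvg F (fun n => \det (intertwiner (t n))) (d%:R ^+ d).
  by rewrite -det_scalar -i0; exact: ccvg_det.
have : (d%:R : C) ^+ d = 0.
  apply: ccvg_uniq h _; rewrite (_ : (fun _ => _) = fun=> 0); first exact: ccvg_cst.
  apply/funext => n; apply/eqP; have [_ _] := ht n.
  by rewrite unitmxE unitfE negbK.
by move/eqP; rewrite expf_eq0 pnatr_eq0 lt0n; case: (d) => [|n]; rewrite ?eqxx ?andbF.
Qed.

Lemma unitary_intertwiner t : 0 <= t ->
  exists U, unitary_mx U /\ forall X, isometric X -> Phi t X = Ad U X.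
Proof.
move=> t0; have [dl dl0 hdl] := intertwiner_unit.
(* Invertibility is known only for times below [dl], so t is cut into n + 1 equal steps. Using t + 1
   as divisor covers t = 0. *)
have [n hn] : exists n : nat, t / n.+1%:R < dl.
  have [n hn] := (ltr_add_invr (x := dl / (t + 1)) (y := 0)) (divr_gt0 dl0 (ltr_wpDl t0 ltr01)).
  exists n; rewrite add0r in hn.
  have : t * n.+1%:R^-1 <= t * (dl / (t + 1)) by rewrite ler_wpM2l // ltW.
  move=> /le_lt_trans; apply.
  by rewrite mulrA ltr_pdivrMr ?ltr_wpDl // mulrC ltr_pM2l // ltrDl.
set s := t / n.+1%:R in hn.
have s0 : 0 <= s by rewrite divr_ge0.
have [U [uU hU]] : exists U, unitary_mx U /\ forall X, isometric X -> Phi s X = Ad U X.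
  apply: (polar_intertwiner isometric_adj) (hdl s s0 hn) _ => [X|X hX].
    exact: QDS_adj.
  exact: intertwinerP.
have iter m : exists U, unitary_mx U /\ forall X, isometric X -> Phi (s *+ m) X = Ad U X.
  elim: m => [|m [W [uW hW]]].
    exists 1%:M; split; first exact: unitary1.
    by move=> X _; rewrite mulr0n QDS0 /Ad mxadj1 mul1mx mulmx1.
  exists (W *m U); split; first exact: unitary_mul.
  move=> X hX; rewrite mulrS QDSD ?mulrn_wge0 // hU; last first.
    by apply: isometric_Phi => //; rewrite mulrn_wge0.
  by rewrite hW // AdM.
have := iter n.+1; rewrite /s -mulr_natr divfK // pnatr_eq0 //.
Qed.

End Semigroup.

(** * Mixedness at large times, limits of mixed times, and the dichotomy *)

Section Dichotomy.
Variables (R : realType) (d : nat) (Phi : R -> 'M[R[i]]_d -> 'M[R[i]]_d).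
Local Notation C := R[i].
Implicit Types (X Y Z U x y : 'M[C]_d).
Hypothesis Q : unital_QDS Phi.
Local Notation mu t := (mixed (@unitary_mx R d) (Phi t)).

Lemma QDS_decay_uniform (I : finType) (Y : I -> 'M[C]_d) (eps : R) : 0 < eps ->
  (forall i, transient Phi (Y i)) ->
  exists2 T, 0 <= T & forall t i, T <= t -> sqnorm (Phi t (Y i)) <= eps.
Proof.
move=> eps0 hY.
have h i : exists T, 0 <= T /\ forall t, T <= t -> sqnorm (Phi t (Y i)) <= eps.
  by have [T T0 hT] := transient_decay Q eps0 (hY i); exists T.
pose T i := projT1 (cid (h i)).
have hT i : 0 <= T i /\ forall t, T i <= t -> sqnorm (Phi t (Y i)) <= eps := projT2 (cid (h i)).
have T0 i : 0 <= T i by case: (hT i).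
(* The sum of finitely many nonnegative times serves as a common upper bound. *)
exists (\sum_i T i); first exact: sumr_ge0.
move=> t i ht; apply: (hT i).2; apply: le_trans ht.
by rewrite (bigD1 i) //= lerDl sumr_ge0.
Qed.

Theorem QDS_eventually_mixed : exists2 T, 0 <= T & forall t, T <= t -> mu t.
Proof.
pose W := isometric Phi.
have Wadj : forall X, W X -> W X^h by exact: isometric_adj.
have GU U : ucommutant W U -> unitary_mx U by case.
have [E [mE Eleft Eright Esym]] := group_mean GU (ucommutant1 W) (@ucommutantM _ _ W)
  (fun U => ucommutant_adj Wadj (U := U)) (@ucommutant_ultra_closed _ _ W).
have [eps eps0 interior] := mean_interior Wadj mE Eleft Eright Esym.
have EW X : W X -> E X = X.
  move=> WX; have [l [lam [U [h0 h1 hU e]]]] := mE.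
  rewrite e (eq_bigr (fun j => (lam j)%:C%C *: X)) => [|j _]; last first.
    by have [uU cU] := hU j; congr (_ *: _); apply/Ad_comm => //; exact: cU.
  by rewrite -scaler_suml -rmorph_sum h1 scale1r.
(* E X lies in the bicommutant of W: it commutes with the unitaries of the commutant, and these span
   the commutant. *)
have Ecomm K X : commutant W K -> K *m E X = E X *m K.
  move: K; apply: (commutant_span Wadj) => [a K K' e e'||U hU].
  - by rewrite mulmxDl mulmxDr -scalemxAl -scalemxAr e e'.
  - by rewrite mul0mx mulmx0.
  - by apply/Ad_comm; [case: hU|exact: Eleft].
pose Y (p : 'I_d * 'I_d) : 'M[C]_d := delta_mx p.1 p.2 - E (delta_mx p.1 p.2).
(* E is self-adjoint and fixes the isometric matrices, so X - E X is orthogonal to them. *)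
have trY p : transient Phi (Y p).
  by move=> Z hZ; rewrite /Y hsBr -Esym EW // subrr.
have [T T0 hT] := QDS_decay_uniform (exprn_gt0 2 eps0) trY.
exists T => // t Tt; have t0 : 0 <= t := le_trans T0 Tt.
have [p [K [eK hu ht]]] := QDS_kraus Q t0.
have [V [uV hV]] := unitary_intertwiner Q t0.
have uV' := unitary_mxE uV.
(* Ad V^h \o Phi t fixes the isometric subspace, so its Kraus operators commute with it *)
pose K' k := K k *m V^h.
have eK' X : kraus K' X = Ad V^h (Phi t X).
  rewrite eK /Ad /kraus mxadjK mulmx_sumr mulmx_suml; apply: eq_bigr => k _.
  by rewrite mxadjM mxadjK !mulmxA.
have hu' : \sum_k (K' k)^h *m K' k = 1%:M.
  transitivity (V *m (\sum_k (K k)^h *m K k) *m V^h); last by rewrite hu mulmx1.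
  rewrite mulmx_sumr mulmx_suml; apply: eq_bigr => k _.
  by rewrite mxadjM mxadjK !mulmxA.
have ht' : \sum_k K' k *m (K' k)^h = 1%:M.
  rewrite -ht; apply: eq_bigr => k _.
  by rewrite mxadjM mxadjK mulmxA -(mulmxA _ V^h V) uV mulmx1.
have fixW X : W X -> kraus K' X = X.
  by move=> WX; rewrite eK' hV // Ad_unitaryK.
have K'W k : commutant W (K' k).
  move=> X WX; have : sqnorm (kraus K' X) = sqnorm X by rewrite fixW.
  by move=> /(kraus_isometryP _ hu' ht') /(_ k); rewrite fixW.
have fixE X : kraus K' (E X) = E X.
  rewrite -[RHS]mulmx1 -hu' mulmx_sumr; apply: eq_bigr => k _.
  by rewrite mulmxA Ecomm //; exact: commutant_adj.
have mK' : mixed (ucommutant W) (kraus K').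
  apply: interior => // i j.
  have linK' := kraus_linear K'.
  have -> : kraus K' (delta_mx i j) - E (delta_mx i j) = kraus K' (Y (i, j)).
    transitivity (kraus K' (-1 *: E (delta_mx i j) + delta_mx i j)).
      by rewrite linK' fixE scaleN1r addrC.
    by rewrite scaleN1r addrC.
  by rewrite eK' Ad_sqnorm; [exact: hT|exact: unitary_adj].
apply: (@mixed_ext _ _ _ (Ad V \o kraus K')).
  by move=> X /=; rewrite eK' -{1}(mxadjK V) Ad_unitaryK //; exact: unitary_adj.
apply: mixed_comp; first exact: unitary_mul.
  exact: mixed_Ad.
exact: mixed_sub mK'.
Qed.

Lemma QDS_mixed_limit (u : nat -> R) t : 0 <= t -> (forall n, 0 <= u n) ->
  (forall n, `|u n - t| <= harmonic n) -> (forall n, mu (u n)) -> mu t.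
Proof.
move=> t0 u0 ut mut; have [F [FU sF]] := nonprincipal_ultra.
have cu : u @ F --> t.
  apply: eventually_ultra => //.
  apply: (@squeeze_cvgr _ _ _ _ (fun n => t - harmonic n) (fun n => t + harmonic n)).
  - by apply: nearW => n; have := ut n; rewrite ler_distl.
  - by rewrite -[X in _ --> X]subr0; apply: cvgB; [exact: cvg_cst|exact: cvg_harmonic].
  - by rewrite -[X in _ --> X]addr0; apply: cvgD; [exact: cvg_cst|exact: cvg_harmonic].
apply: (mixed_closed (F := F) _ (@unitary_ultra_closed R d F FU) mut) => // X.
exact: QDS_cvg.
Qed.

Lemma QDS_mixed0 : mu 0.
Proof.
apply: mixed_ext (mixed_Ad (unitary1 _ d)) => X.
by rewrite (QDS0 Q) /Ad mxadj1 mul1mx mulmx1.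
Qed.

Lemma QDS_mixed_mulrn s m : 0 <= s -> mu s -> mu (s *+ m).
Proof.
move=> s0 ms; elim: m => [|m ih]; first exact: QDS_mixed0.
apply: (@mixed_ext _ _ _ (Phi s \o Phi (s *+ m))).
  by move=> X; rewrite mulrS (QDSD Q) // mulrn_wge0.
by apply: mixed_comp => //; exact: unitary_mul.
Qed.

(** If mixed times s accumulate at 0, then their multiples, mixed by composition, approximate any t:
    rounding t down to a multiple of s costs less than s. *)
Lemma QDS_mixed_all : (forall e, 0 < e -> exists s, [/\ 0 < s, s < e & mu s]) ->
  forall t, 0 <= t -> mu t.
Proof.
move=> h t t0.
have hn n : exists s, [/\ 0 < s, s < harmonic n & mu s] by apply: h; exact: harmonic_gt0.
pose s n := projT1 (cid (hn n)).
have hs n : [/\ 0 < s n, s n < harmonic n & mu (s n)] := projT2 (cid (hn n)).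
apply: (@QDS_mixed_limit (fun n => s n *+ Num.truncn (t / s n))) => // n;
  have [sn0 snh msn] := hs n.
- by rewrite mulrn_wge0 // ltW.
- have /andP[lo hi] := truncn_itv (divr_ge0 t0 (ltW sn0)).
  rewrite ler_pdivlMr // in lo; rewrite ltr_pdivrMr // -natr1 mulrDl mul1r in hi.
  rewrite -mulr_natl ler_distl; apply/andP; split; lra.
- by apply: QDS_mixed_mulrn => //; exact: ltW.
Qed.

End Dichotomy.

Unset Implicit Arguments.
Set Strict Implicit.
Set Printing Implicit Defensive.

Theorem theorem5p4 (R : realType) (d : nat) (Phi : R -> 'M[R[i]]_d -> 'M[R[i]]_d) :
  unital_QDS Phi ->
  open [set t : R | 0 <= t /\ ~ mixed_unitary (Phi t)] /\
  (let P1 := forall t : R, 0 <= t -> mixed_unitary (Phi t) in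
   let P2 := exists t0 t1 : R, [/\ 0 < t0, t0 <= t1,
               forall t, 0 < t -> t < t0 -> ~ mixed_unitary (Phi t)
             & forall t, t1 <= t -> mixed_unitary (Phi t)] in
   (P1 \/ P2) /\ ~ (P1 /\ P2)).
Proof.
move=> Q; split; last split.
- rewrite openE => t [t0 nmt] /=.
  (* Phi_0 is mixed unitary, so the boundary point 0 is excluded; this is why the set is open in R
     and not merely in the half-line. *)
  have tpos : 0 < t.
    by rewrite lt_neqAle t0 andbT; apply/eqP => t00; apply: nmt; rewrite -t00; exact: QDS_mixed0.
  apply: contrapT => nn.
  have hn n : exists s, [/\ 0 <= s, `|s - t| <= harmonic n & mixed_unitary (Phi s)].
    apply: contrapT => /forallNP neg; apply: nn; apply/nbhs_ballP.
    (* The bound t on the radius keeps the whole ball inside the half-line. *)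
    exists (Num.min (harmonic n) t); first by rewrite /= lt_min harmonic_gt0.
    move=> s; rewrite /ball /= lt_min => /andP[h1 h2].
    have s0 : 0 <= s by move: h2; rewrite ltr_norml => /andP[_]; lra.
    split=> // ms; apply: (neg s); split=> //.
    by rewrite distrC ltW.
  pose s n := projT1 (cid (hn n)).
  have hs n : [/\ 0 <= s n, `|s n - t| <= harmonic n & mixed_unitary (Phi (s n))].
    exact: (projT2 (cid (hn n))).
  by apply: nmt; apply: (QDS_mixed_limit Q (u := s)) => // n; case: (hs n).
- have [[t0 [t0pos h]]|neg] := pselect (exists t0 : R, 0 < t0 /\
      forall t, 0 < t -> t < t0 -> ~ mixed_unitary (Phi t)).
    have [T T0 hT] := QDS_eventually_mixed Q.
    (* The maximum with [t0] is taken only to ensure t0 <= t1. *)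
    right; exists t0, (Num.max t0 T); split=> //; first by rewrite le_max lexx.
    by move=> t; rewrite ge_max => /andP[_]; exact: hT.
  (* If no initial interval is free of mixed times, then mixed times accumulate at 0. *)
  left; apply: QDS_mixed_all => // e e0.
  apply: contrapT => /forallNP h; apply: neg; exists e; split=> // t tpos te mt.
  by apply: (h t).
- move=> [P1 [t0 [t1 [t0pos _ h _]]]].
  apply: (h (t0 / 2)); [lra|lra|].
  by apply: P1; lra.
Qed.
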